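(* Let $R$ be an associative commutative ring with identity and let $P$ be an $R\mathbb{A}$-module. (i) $P$ is finitely generated projective if and only if there exist finitely generated projective $R$-modules $P_1,P_2,P_3,P_4$ such that $$P\cong K_1(P_1)\oplus K_2(P_2)\oplus E_{a_3}(P_3)\oplus E_{a_4}(P_4).$$ (ii) Suppose that there exist finitely generated projective $R$-modules $P_1,P_2,P_3,P_4$ such that $P\cong K_1(P_1)\oplus K_2(P_2)\oplus E_{a_3}(P_3)\oplus E_{a_4}(P_4)$. Then $$P_1\cong S_{a_1}P,\qquad P_2\cong S_{a_2}P,\qquad P_3\cong\mathrm{coker}\bigl(P(f_{34})\colon P(a_4)\to P(a_3)\bigr),\qquad P_4\cong P(a_4).$$ (iii) $P$ is finitely generated free if and only if there exist finitely generated free $R$-modules $F_1,F_2,F_3,F_4$ such that $$P\cong K_1(F_1)\oplus K_2(F_2)\oplus E_{a_3}(F_1\oplus F_2\oplus F_3)\oplus E_{a_4}(F_4).$$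
   Context: $\mathbb{A}$ is the category with four objects $a_1,a_2,a_3,a_4$ and morphism sets $\mathrm{mor}(a_1,a_1)=\{\mathrm{id},f_{11}\}$, $\mathrm{mor}(a_1,a_2)=\{f_{12},g_{12}\}$, $\mathrm{mor}(a_1,a_3)=\{f_{13}\}$, $\mathrm{mor}(a_1,a_4)=\{f_{14}\}$, $\mathrm{mor}(a_2,a_1)=\{f_{21},g_{21}\}$, $\mathrm{mor}(a_2,a_2)=\{\mathrm{id},f_{22}\}$, $\mathrm{mor}(a_2,a_3)=\{f_{23}\}$, $\mathrm{mor}(a_2,a_4)=\{f_{24},g_{24}\}$, $\mathrm{mor}(a_3,a_1)=\{f_{31}\}$, $\mathrm{mor}(a_3,a_2)=\{f_{32}\}$, $\mathrm{mor}(a_3,a_3)=\{\mathrm{id}=f_{33}\}$, $\mathrm{mor}(a_3,a_4)=\{f_{34}\}$, $\mathrm{mor}(a_4,a_4)=\{\mathrm{id}=f_{44}\}$, and $\mathrm{mor}(a_4,a_j)=\emptyset$ for $j\ne4$. Composition: for non-identity morphisms $p\colon a_i\to a_j$ and $q\colon a_j\to a_k$, $q\circ p=f_{ik}$. An $R\mathbb{A}$-module is a functor $\mathbb{A}^{op}\to R\text{-Mod}$. $R\,\mathrm{mor}(?,x)$ sends $y$ to the free $R$-module on $\mathrm{mor}(y,x)$. Finitely generated free: isomorphic to a finite direct sum of such modules; finitely generated projective: direct summand of a finitely generated free one. For an $R$-module $Q$ and $j\in\{3,4\}$, $E_{a_j}(Q):=Q\otimes_RR\,\mathrm{mor}(?,a_j)$.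 For $i\in\{1,2\}$, $K_i(Q)$ is the $R\mathbb{A}$-module with value $Q$ at $a_1$ and $a_2$ and value $0$ at $a_3$ and $a_4$, in which $g_{21}$ (if $i=1$), respectively $g_{12}$ (if $i=2$), induces $\mathrm{id}_Q$, and all other morphisms except $\mathrm{id}_{a_1},\mathrm{id}_{a_2}$ induce zero. $S_{a_i}P$ is the quotient of $P(a_i)$ by the submodule generated by the images of $P(u)\colon P(y)\to P(a_i)$ for all morphisms $u\colon a_i\to y$ which are not isomorphisms. *)

(* Defs.v *)
From HB Require Import structures.
From mathcomp Require Import all_boot all_order all_algebra.
From mathcomp Require Import finmap.
From mathcomp Require Import boolp classical_sets functions cardinality fsbigop.

Set Implicit Arguments.
Unset Strict Implicit.
Unset Printing Implicit Defensive.

Import GRing.Theory.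
Local Open Scope classical_set_scope.
Local Open Scope ring_scope.
Local Open Scope quotient_scope.

Definition lmod_iso (R : pzRingType) (M N : lmodType R) : Prop :=
  exists f : {linear M -> N}, bijective f.

Definition fg_free (R : pzRingType) (M : lmodType R) : Prop :=
  exists n : nat, lmod_iso M 'rV[R]_n.

Definition fg_projective (R : pzRingType) (M : lmodType R) : Prop :=
  exists M' F : lmodType R, fg_free F /\ lmod_iso (M * M')%type F.

Section QuotientModule.
Variables (R : pzRingType) (M : lmodType R) (A : set M).

Inductive lspan : M -> Prop :=
| lspan_sub x of A x : lspan x
| lspan0 : lspan 0
| lspan_lin a x y of lspan x & lspan y : lspan (a *: x + y).

Definition in_lspan : {pred M} := fun x => `[< lspan x >].

Fact in_lspan_closed : zmod_closed in_lspan.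
Proof.
split=> [|x y /asboolP sx /asboolP sy]; apply/asboolP; first exact: lspan0.
by rewrite addrC -scaleN1r; exact: lspan_lin.
Qed.
HB.instance Definition _ := GRing.isZmodClosed.Build M in_lspan in_lspan_closed.

Fact in_lspanZ a x : x \in in_lspan -> a *: x \in in_lspan.
Proof.
move=> /asboolP sx; apply/asboolP; rewrite -[_ *: _]addr0.
by apply: lspan_lin => //; exact: lspan0.
Qed.

(* The quotient of M by the submodule generated by A. *)
Definition lquot := Quotient.quot in_lspan.
HB.instance Definition _ := GRing.Zmodule.on lquot.
HB.instance Definition _ := Quotient.on lquot.

Definition lquot_pi (x : M) : lquot := \pi_lquot x.

Fact lquot_pi_eq x y : (lquot_pi x == lquot_pi y) = (x - y \in in_lspan).
Proof. by rewrite Quotient.idealrBE. Qed.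

Fact lquot_piD x y : lquot_pi (x + y) = lquot_pi x + lquot_pi y.
Proof. exact: (@Quotient.pi_add _ in_lspan). Qed.

Definition lquot_scale (a : R) (q : lquot) : lquot := lquot_pi (a *: repr q).

Fact lquot_pi_repr q : lquot_pi (repr q) = q.
Proof. exact: reprK. Qed.

Fact lquot_piZ a x : lquot_pi (a *: x) = lquot_scale a (lquot_pi x).
Proof.
apply/eqP; rewrite lquot_pi_eq -scalerBr in_lspanZ //.
by rewrite -lquot_pi_eq lquot_pi_repr.
Qed.

Fact lquot_scaleA a b q :
  lquot_scale a (lquot_scale b q) = lquot_scale (a * b) q.
Proof. by rewrite -[q]lquot_pi_repr -!lquot_piZ scalerA. Qed.

Fact lquot_scale1 : left_id 1 lquot_scale.
Proof. by move=> q; rewrite -[q]lquot_pi_repr -lquot_piZ scale1r. Qed.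

Fact lquot_scaleDr : right_distributive lquot_scale +%R.
Proof.
move=> a p q; rewrite -[p]lquot_pi_repr -[q]lquot_pi_repr.
by rewrite -lquot_piD -!lquot_piZ scalerDr lquot_piD.
Qed.

Fact lquot_scaleDl q : {morph lquot_scale^~ q : a b / a + b}.
Proof.
move=> a b; rewrite -[q]lquot_pi_repr.
by rewrite -!lquot_piZ scalerDl lquot_piD.
Qed.

HB.instance Definition _ := GRing.Zmodule_isLmodule.Build R lquot
  lquot_scaleA lquot_scale1 lquot_scaleDr lquot_scaleDl.

Fact lquot_pi_linear : linear lquot_pi.
Proof. by move=> a x y; rewrite lquot_piD lquot_piZ. Qed.
HB.instance Definition _ :=
  GRing.isLinear.Build R M lquot *:%R lquot_pi lquot_pi_linear.

End QuotientModule.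

Section QuotientMap.
Variables (R : pzRingType) (M N : lmodType R) (A : set M) (B : set N).
Variable (f : {linear M -> N}).

Definition lquot_map (q : lquot A) : lquot B := lquot_pi B (f (repr q)).

Hypothesis fAB : forall x, A x -> lspan B (f x).

Fact lquot_map_pi x : lquot_map (lquot_pi A x) = lquot_pi B (f x).
Proof.
apply/eqP; rewrite lquot_pi_eq -linearB; apply/asboolP.
have: repr (lquot_pi A x) - x \in in_lspan A.
  by rewrite -lquot_pi_eq lquot_pi_repr.
move=> /asboolP; elim=> [y /fAB//||a y z _ sy _ sz].
  by rewrite linear0; exact: lspan0.
by rewrite linearP; exact: lspan_lin.
Qed.

Fact lquot_map_linear : linear lquot_map.
Proof.
move=> a p q; rewrite -[p]lquot_pi_repr -[q]lquot_pi_repr.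
by rewrite -linearP !lquot_map_pi !linearP.
Qed.

End QuotientMap.

Definition coker (R : pzRingType) (M N : lmodType R) (f : {linear M -> N}) :
  lmodType R := lquot (range f).

Section FreeModule.
Variables (R : pzRingType) (T : choiceType).

Definition fin_supp : {pred T -> R^o} :=
  fun u => `[< finite_set [set t | u t != 0] >].

Fact fin_supp_closed : submod_closed fin_supp.
Proof.
split=> [|a u v /asboolP fu /asboolP fv]; apply/asboolP.
  by rewrite (_ : [set _ | _] = set0) // -subset0 => t /=; rewrite eqxx.
apply: (@sub_finite_set _ _ ([set t | u t != 0] `|` [set t | v t != 0])).
  move=> t /= /eqP auv; apply: contrapT => /not_orP[/negP/negPn/eqP u0].
  move=> /negP/negPn/eqP v0; apply: auv.
  by rewrite -[LHS]/(a * u t + v t) u0 v0 mulr0 addr0.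
by rewrite finite_setU.
Qed.
HB.instance Definition _ :=
  GRing.isSubmodClosed.Build R (T -> R^o) fin_supp fin_supp_closed.

(* The free R-module on T: the finitely supported functions from T to R. *)
Record freemod := FreeMod {
  freemod_fun :> T -> R^o;
  freemodP : freemod_fun \in fin_supp }.
HB.instance Definition _ := [isSub for freemod_fun].
HB.instance Definition _ := [Choice of freemod by <:].
HB.instance Definition _ := [SubChoice_isSubLmodule of freemod by <:].

Definition indic_fun (t : T) : T -> R^o := fun s => (s == t)%:R.

Fact indic_fun_supp t : indic_fun t \in fin_supp.
Proof.
apply/asboolP; apply: (@sub_finite_set _ _ [set t]) => // s /=.
by rewrite /indic_fun; case: (s =P t) => // _; rewrite eqxx.
Qed.

Definition fbasis (t : T) : freemod := FreeMod (indic_fun_supp t).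

Section Extension.
Variables (M : lmodType R) (f : T -> M).

(* The linear extension of f : T -> M along fbasis : T -> freemod. *)
Definition lin_ext (u : freemod) : M := \sum_(t \in setT) (u t : R) *: f t.

Fact lin_extE (X : set T) (u : freemod) :
    finite_set X -> [set t | u t != 0] `<=` X ->
  lin_ext u = \sum_(t <- fset_set X) (u t : R) *: f t.
Proof.
move=> finX uX; rewrite -(fsbig_finite _ _ finX).
apply/esym/fsbig_widen => // t [_ Xt] /=.
case: (eqVneq (u t) 0) => [->|u0]; first by rewrite scale0r.
by case: Xt; exact: uX.
Qed.

Fact lin_ext_linear : linear lin_ext.
Proof.
move=> a u v.
have /asboolP finu := freemodP u; have /asboolP finv := freemodP v.
set X := [set t | u t != 0] `|` [set t | v t != 0].
have finX : finite_set X by rewrite finite_setU.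
have uX : [set t | u t != 0] `<=` X by move=> t; left.
have vX : [set t | v t != 0] `<=` X by move=> t; right.
have uvX : [set t | (a *: u + v : freemod) t != 0] `<=` X.
  move=> t /= /eqP auv; apply: contrapT => /not_orP[/negP/negPn/eqP u0].
  move=> /negP/negPn/eqP v0; apply: auv.
  by rewrite -[LHS]/(a * u t + v t) u0 v0 mulr0 addr0.
rewrite (lin_extE finX uvX) (lin_extE finX uX) (lin_extE finX vX).
rewrite scaler_sumr -big_split; apply: eq_bigr => t _ /=.
by rewrite -[X in X *: _]/(a * u t + v t) scalerDl scalerA.
Qed.
HB.instance Definition _ :=
  GRing.isLinear.Build R freemod M *:%R lin_ext lin_ext_linear.

Fact lin_ext_basis t : lin_ext (fbasis t) = f t.
Proof.
rewrite (@lin_extE [set t]) //; last first.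
  move=> s /=; rewrite /indic_fun; case: (s =P t) => // _.
  by rewrite eqxx.
by rewrite fset_set1 big_seq_fset1 /= /indic_fun eqxx scale1r.
Qed.

End Extension.

Fact lin_ext_id (u : freemod) : lin_ext fbasis u = u.
Proof.
have /asboolP finu := freemodP u.
rewrite (lin_extE _ finu) //; apply/val_inj/funext => s /=.
rewrite (@big_morph _ _ (fun w : freemod => w s) 0 +%R) //.
rewrite (eq_bigr (fun t => if s == t then u t else 0)); last first.
  move=> t _; rewrite -[LHS]/(u t * (s == t)%:R).
  by case: eqP; rewrite ?mulr1 ?mulr0.
have [us0|us] := eqVneq (u s) 0.
  by rewrite us0 big1 // => t _; case: eqP => // <-.
rewrite (big_fsetD1 s) ?in_fset_set ?inE //= eqxx big_seq big1 ?addr0 // => t.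
by rewrite !inE eq_sym => /andP[/negPf-> _].
Qed.

Fact lin_ext_comp (M N : lmodType R) (g : {linear M -> N}) (f : T -> M) u :
  g (lin_ext f u) = lin_ext (g \o f) u.
Proof.
have /asboolP finu := freemodP u.
rewrite !(lin_extE _ finu) // linear_sum.
by apply: eq_bigr => t _; rewrite linearZ.
Qed.

Fact freemod_ext (M : lmodType R) (g h : {linear freemod -> M}) :
  (forall t, g (fbasis t) = h (fbasis t)) -> g =1 h.
Proof.
move=> gh u; rewrite -[u]lin_ext_id !lin_ext_comp.
by congr (lin_ext _ u); apply/funext.
Qed.

End FreeModule.

Section TensorProduct.
Variables (R : comPzRingType) (Q M : lmodType R).

Inductive tensor_rel : set (freemod R (Q * M)%type) :=
| tensor_relDl q q' m :
    tensor_rel (fbasis R (q + q', m) - (fbasis R (q, m) + fbasis R (q', m)))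
| tensor_relDr q m m' :
    tensor_rel (fbasis R (q, m + m') - (fbasis R (q, m) + fbasis R (q, m')))
| tensor_relZl a q m :
    tensor_rel (fbasis R (a *: q, m) - a *: fbasis R (q, m))
| tensor_relZr a q m :
    tensor_rel (fbasis R (q, a *: m) - a *: fbasis R (q, m)).

Definition tensor : lmodType R := lquot tensor_rel.

End TensorProduct.

Section TensorMap.
Variables (R : comPzRingType) (Q M N : lmodType R) (g : {linear M -> N}).

Definition tensor_pre : freemod R (Q * M)%type -> freemod R (Q * N)%type :=
  lin_ext (fun x => fbasis R (x.1, g x.2)).
HB.instance Definition _ := GRing.Linear.on tensor_pre.

Fact tensor_pre_basis q m :
  tensor_pre (fbasis R (q, m)) = fbasis R (q, g m).
Proof. exact: lin_ext_basis. Qed.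

Fact tensor_pre_rel x :
  tensor_rel x -> lspan (@tensor_rel R Q N) (tensor_pre x).
Proof.
case=> [q q' m|q m m'|a q m|a q m]; apply: lspan_sub.
- rewrite (linearB tensor_pre) (linearD tensor_pre) /= !tensor_pre_basis.
  exact: tensor_relDl.
- rewrite (linearB tensor_pre) (linearD tensor_pre) /= !tensor_pre_basis linearD.
  exact: tensor_relDr.
- rewrite (linearB tensor_pre) (linearZZ tensor_pre) /= !tensor_pre_basis.
  exact: tensor_relZl.
- rewrite (linearB tensor_pre) (linearZZ tensor_pre) /= !tensor_pre_basis linearZ.
  exact: tensor_relZr.
Qed.

(* The map id_Q (x) g. *)
Definition tensor_map : tensor Q M -> tensor Q N :=
  lquot_map (@tensor_rel R Q N) tensor_pre.
HB.instance Definition _ := GRing.isLinear.Build R (tensor Q M) (tensor Q N)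
  *:%R tensor_map (lquot_map_linear tensor_pre_rel).

Fact tensor_map_pi x :
  tensor_map (lquot_pi _ x) = lquot_pi _ (tensor_pre x).
Proof. exact: lquot_map_pi tensor_pre_rel x. Qed.

End TensorMap.

Fact tensor_pre_id (R : comPzRingType) (Q M : lmodType R)
    (g : {linear M -> M}) (u : freemod R (Q * M)%type) :
  g =1 id -> tensor_pre g u = u.
Proof.
move=> g1; apply: etrans (lin_ext_id u); rewrite /tensor_pre.
have -> // : (fun x => fbasis R (x.1, g x.2)) = @fbasis R (Q * M)%type.
by apply/funext => -[q m]; rewrite g1.
Qed.

Fact tensor_pre_comp (R : comPzRingType) (Q M N L : lmodType R)
    (g : {linear M -> N}) (h : {linear N -> L}) (k : {linear M -> L})
    (u : freemod R (Q * M)%type) :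
  k =1 h \o g -> tensor_pre k u = tensor_pre h (tensor_pre g u).
Proof.
move=> kE.
apply: etrans (esym (lin_ext_comp (tensor_pre h) _ u)); rewrite /tensor_pre.
suff -> : (fun x => fbasis R (x.1, k x.2)) =
  lin_ext (fun x : Q * N => fbasis R (x.1, h x.2)) \o
    (fun x : Q * M => fbasis R (x.1, g x.2)) by [].
by apply/funext => -[q m]; rewrite /= lin_ext_basis kE.
Qed.

Fact tensor_map_id (R : comPzRingType) (Q M : lmodType R)
    (g : {linear M -> M}) (t : tensor Q M) :
  g =1 id -> tensor_map g t = t.
Proof.
move=> g1; rewrite -(lquot_pi_repr t) tensor_map_pi.
by rewrite (tensor_pre_id _ g1).
Qed.

Fact tensor_map_comp (R : comPzRingType) (Q M N L : lmodType R)
    (g : {linear M -> N}) (h : {linear N -> L}) (k : {linear M -> L})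
    (t : tensor Q M) :
  k =1 h \o g -> tensor_map k t = tensor_map h (tensor_map g t).
Proof.
move=> kE; rewrite -(lquot_pi_repr t) !tensor_map_pi.
by rewrite (tensor_pre_comp _ kE).
Qed.

Record category := Category {
  obj :> Type;
  mor : obj -> obj -> choiceType;
  mor_id : forall x, mor x x;
  mor_comp : forall x y z, mor y z -> mor x y -> mor x z;
  mor_comp_idl : forall x y (p : mor x y), mor_comp (mor_id y) p = p;
  mor_comp_idr : forall x y (p : mor x y), mor_comp p (mor_id x) = p;
  mor_compA : forall x y z w (r : mor z w) (q : mor y z) (p : mor x y),
    mor_comp r (mor_comp q p) = mor_comp (mor_comp r q) p }.

Definition is_iso (C : category) (x y : C) (u : mor x y) : Prop :=
  exists v : mor y x, mor_comp v u = mor_id x /\ mor_comp u v = mor_id y.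

(* RC-modules: functors from C^op to R-modules; cact u is the image of u. *)
Record cmodule (R : pzRingType) (C : category) := CModule {
  cval :> C -> lmodType R;
  cact : forall x y, mor x y -> {linear cval y -> cval x};
  cact1 : forall x v, cact (mor_id x) v = v;
  cactM : forall x y z (q : mor y z) (p : mor x y) v,
    cact (mor_comp q p) v = cact p (cact q v) }.

Section ModulesOverCategory.
Variables (R : pzRingType) (C : category).
Implicit Types (M N P : cmodule R C).

Definition cmod_iso M N : Prop :=
  exists f : forall x, {linear M x -> N x},
    (forall x, bijective (f x)) /\
    (forall x y (u : mor x y) v, f x (cact M u v) = cact N u (f y v)).

Section DirectSum.
Variables M N : cmodule R C.

Definition dsum_act x y (u : mor x y) (v : (M y * N y)%type) :
  (M x * N x)%type := (cact M u v.1, cact N u v.2).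

Fact dsum_act_linear x y (u : mor x y) : linear (dsum_act u).
Proof. by move=> a v w; rewrite /dsum_act /= !linearP. Qed.
HB.instance Definition _ x y (u : mor x y) := GRing.isLinear.Build R
  (M y * N y)%type (M x * N x)%type *:%R (dsum_act u) (dsum_act_linear u).

Fact dsum_act1 x v : dsum_act (mor_id x) v = v.
Proof. by case: v => v w; rewrite /dsum_act /= !cact1. Qed.

Fact dsum_actM x y z (q : mor y z) (p : mor x y) v :
  dsum_act (mor_comp q p) v = dsum_act p (dsum_act q v).
Proof. by rewrite /dsum_act /= !cactM. Qed.

Definition dsum : cmodule R C :=
  @CModule R C (fun x => (M x * N x)%type) (fun x y u => dsum_act u)
    dsum_act1 dsum_actM.

End DirectSum.

Definition czero : cmodule R C :=
  @CModule R C (fun _ => 'rV[R]_0) (fun _ _ _ => idfun)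
    (fun _ _ => erefl) (fun _ _ _ _ _ _ => erefl).

Section Representable.
Variable x : C.

Definition rmor_act y z (p : mor y z) :
    freemod R (mor z x) -> freemod R (mor y x) :=
  lin_ext (fun u => fbasis R (mor_comp u p)).
HB.instance Definition _ y z (p : mor y z) := GRing.Linear.on (rmor_act p).

Fact rmor_act1 y v : rmor_act (mor_id y) v = v.
Proof.
rewrite -[RHS]lin_ext_id; congr (lin_ext _ v).
by apply/funext => u; rewrite mor_comp_idr.
Qed.

Fact rmor_actM y z w (q : mor z w) (p : mor y z) v :
  rmor_act (mor_comp q p) v = rmor_act p (rmor_act q v).
Proof.
rewrite [RHS]lin_ext_comp; congr (lin_ext _ v).
by apply/funext => u; rewrite /= /rmor_act lin_ext_basis mor_compA.
Qed.

(* R mor(?, x). *)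
Definition rmor : cmodule R C :=
  @CModule R C (fun y => freemod R (mor y x)) (fun y z p => rmor_act p)
    rmor_act1 rmor_actM.

End Representable.

Definition cfg_free P : Prop :=
  exists s : seq C, cmod_iso P (foldr (fun x => dsum (rmor x)) czero s).

Definition cfg_projective P : Prop :=
  exists P' F : cmodule R C, cfg_free F /\ cmod_iso (dsum P P') F.

Definition S_ P (x : C) : lmodType R :=
  lquot [set v : P x | exists (y : C) (u : mor x y),
    ~ is_iso u /\ range (cact P u) v].

End ModulesOverCategory.

(* The functor y |-> Q (x) R mor(y, x). *)
Definition E_ (R : comPzRingType) (C : category) (x : C) (Q : lmodType R) :
    cmodule R C :=
  @CModule R C (fun y => tensor Q (rmor R x y))
    (fun y z p => tensor_map (cact (rmor R x) p))
    (fun y t => tensor_map_id t (@cact1 _ _ (rmor R x) y))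
    (fun y z w q p t => tensor_map_comp t (@cactM _ _ (rmor R x) _ _ _ q p)).

Inductive objA := a1 | a2 | a3 | a4.

(* id3 and id4 are also called f_33 and f_44. *)
Inductive morA : objA -> objA -> Type :=
| id1 : morA a1 a1 | f11 : morA a1 a1
| f12 : morA a1 a2 | g12 : morA a1 a2
| f13 : morA a1 a3
| f14 : morA a1 a4
| f21 : morA a2 a1 | g21 : morA a2 a1
| id2 : morA a2 a2 | f22 : morA a2 a2
| f23 : morA a2 a3
| f24 : morA a2 a4 | g24 : morA a2 a4
| f31 : morA a3 a1
| f32 : morA a3 a2
| id3 : morA a3 a3
| f34 : morA a3 a4
| id4 : morA a4 a4.

HB.instance Definition _ x y := gen_eqMixin (morA x y).
HB.instance Definition _ x y := gen_choiceMixin (morA x y).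

Fact morA_ind1 (P : forall z, morA a1 z -> Prop) :
  P _ id1 -> P _ f11 -> P _ f12 -> P _ g12 -> P _ f13 -> P _ f14 ->
  forall z q, P z q.
Proof.
move=> *.
pose G y : forall z, morA y z -> Prop :=
  match y with a1 => P | _ => fun _ _ => True end.
suff H y z (q : morA y z) : G y z q by exact: (H a1).
by case: q.
Qed.

Fact morA_ind2 (P : forall z, morA a2 z -> Prop) :
  P _ f21 -> P _ g21 -> P _ id2 -> P _ f22 -> P _ f23 -> P _ f24 -> P _ g24 ->
  forall z q, P z q.
Proof.
move=> *.
pose G y : forall z, morA y z -> Prop :=
  match y with a2 => P | _ => fun _ _ => True end.
suff H y z (q : morA y z) : G y z q by exact: (H a2).
by case: q.
Qed.

Fact morA_ind3 (P : forall z, morA a3 z -> Prop) :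
  P _ f31 -> P _ f32 -> P _ id3 -> P _ f34 ->
  forall z q, P z q.
Proof.
move=> *.
pose G y : forall z, morA y z -> Prop :=
  match y with a3 => P | _ => fun _ _ => True end.
suff H y z (q : morA y z) : G y z q by exact: (H a3).
by case: q.
Qed.

Fact morA_ind4 (P : forall z, morA a4 z -> Prop) :
  P _ id4 ->
  forall z q, P z q.
Proof.
move=> *.
pose G y : forall z, morA y z -> Prop :=
  match y with a4 => P | _ => fun _ _ => True end.
suff H y z (q : morA y z) : G y z q by exact: (H a4).
by case: q.
Qed.

Ltac case_morA q :=
  move: q; first [elim/morA_ind1 | elim/morA_ind2 | elim/morA_ind3
                 | elim/morA_ind4].

Definition idA (x : objA) : morA x x :=
  match x with a1 => id1 | a2 => id2 | a3 => id3 | a4 => id4 end.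

Definition f1_ (k : objA) : morA a1 k :=
  match k with a1 => f11 | a2 => f12 | a3 => f13 | a4 => f14 end.
Definition f2_ (k : objA) : morA a2 k :=
  match k with a1 => f21 | a2 => f22 | a3 => f23 | a4 => f24 end.
Definition f3_ (k : objA) : morA a3 k :=
  match k with a1 => f31 | a2 => f32 | a3 => id3 | a4 => f34 end.

(* compAA q p is q after p: it is p if q is an identity, q if p is an identity,
   and f_ik otherwise. *)
Definition after_nonid x y z (p : morA x y) : morA y z -> morA x z :=
  match p in morA x y return morA y z -> morA x z with
  | id1 | id2 | id3 | id4 => fun q => q
  | f11 | f12 | g12 | f13 | f14 => fun _ => f1_ z
  | f21 | g21 | f22 | f23 | f24 | g24 => fun _ => f2_ z
  | f31 | f32 | f34 => fun _ => f3_ z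
  end.

Definition compAA x y z (q : morA y z) (p : morA x y) : morA x z :=
  match q in morA y z return morA x y -> morA x z with
  | id1 | id2 | id3 | id4 => fun p => p
  | nonid => fun p => after_nonid p nonid
  end p.

Fact compAA_idl x y (p : morA x y) : compAA (idA y) p = p.
Proof. by case: p. Qed.

Fact compAA_idr x y (p : morA x y) : compAA p (idA x) = p.
Proof. by case: p. Qed.

Fact compAA_assoc x y z w (r : morA z w) (q : morA y z) (p : morA x y) :
  compAA r (compAA q p) = compAA (compAA r q) p.
Proof.
by move: r q; case: p => r q; move: r; case_morA q => r; case_morA r.
Qed.

Definition catAA : category :=
  @Category objA morA idA compAA compAA_idl compAA_idr compAA_assoc.

Section KModules.
Variables (R : pzRingType) (Q : lmodType R).

Definition K_val (x : objA) : lmodType R :=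
  match x with a1 | a2 => Q | a3 | a4 => 'rV[R]_0 end.

Definition K1_act x y (u : morA x y) : {linear K_val y -> K_val x} :=
  match u in morA x y return {linear K_val y -> K_val x} with
  | id1 | id2 | g21 => idfun
  | _ => \0
  end.

Definition K2_act x y (u : morA x y) : {linear K_val y -> K_val x} :=
  match u in morA x y return {linear K_val y -> K_val x} with
  | id1 | id2 | g12 => idfun
  | _ => \0
  end.

Fact K1_act_id x v : K1_act (idA x) v = v.
Proof. by case: x v => v //=; rewrite [RHS]thinmx0. Qed.

Fact K1_actM x y z (q : morA y z) (p : morA x y) v :
  K1_act (compAA q p) v = K1_act p (K1_act q v).
Proof.
by move: q v; case: p => q; case_morA q => v /=; rewrite ?linear0.
Qed.

Fact K2_act_id x v : K2_act (idA x) v = v.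
Proof. by case: x v => v //=; rewrite [RHS]thinmx0. Qed.

Fact K2_actM x y z (q : morA y z) (p : morA x y) v :
  K2_act (compAA q p) v = K2_act p (K2_act q v).
Proof.
by move: q v; case: p => q; case_morA q => v /=; rewrite ?linear0.
Qed.

Definition K1_ : cmodule R catAA :=
  @CModule R catAA K_val K1_act K1_act_id K1_actM.
Definition K2_ : cmodule R catAA :=
  @CModule R catAA K_val K2_act K2_act_id K2_actM.

End KModules.

(* K_1(P1) (+) K_2(P2) (+) E_{a3}(P3) (+) E_{a4}(P4). *)
Definition KKEE (R : comPzRingType) (P1 P2 P3 P4 : lmodType R) :
    cmodule R catAA :=
  dsum (dsum (dsum (K1_ P1) (K2_ P2)) (E_ (a3 : catAA) P3)) (E_ (a4 : catAA) P4).

(* Main.v *)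
Require Import Defs.
From HB Require Import structures.
From mathcomp Require Import all_boot all_order all_algebra.
From mathcomp Require Import boolp classical_sets.

Set Implicit Arguments.
Unset Strict Implicit.
Unset Printing Implicit Defensive.

Import GRing.Theory.
Local Open Scope classical_set_scope.
Local Open Scope ring_scope.

(** The category has a retract [a3] of both [a1] and [a2], so for every module
[P] one has [P a1 = im f13 (+) ker f31] and [P a2 = im f23 (+) ker f32], with
both images isomorphic to [P a3].  After splitting them off, what remains of
[P] is the following data: the modules [ker f31], [ker f32], [P a3], [P a4],
the maps [g21 : ker f31 -> ker f32] and [g12] in the other direction, the map
[f34 : P a4 -> P a3], and the difference [g24 - f24 : P a4 -> ker f32].
The composites of [g12] with [g21], and of [g12] with this difference, vanish
between the kernels.

In these terms a sum [K_1(Q1) (+) K_2(Q2) (+) E_{a3}(Q3) (+) E_{a4}(Q4)] is a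
module that has generators [Qi -> P ai] such that
[ker f31 = Q1 (+) g12 Q2], [ker f32 = g21 Q1 (+) Q2 (+) (g24 - f24) Q4],
[P a3 = Q3 (+) f34 Q4] and [P a4 = Q4].  This is the predicate [decomp].
Such generators determine the module ([decomp_unique]), and the sum in
question has them ([KKEE_decomp]), whence [cmod_iso_KKEE]: the isomorphisms of
the theorem may be replaced by [decomp] everywhere.

Free modules.  A module free on [Q] at [a1] decomposes as [(Q, 0, Q, 0)], since
[id - f11] and [f31] generate complementary summands; at [a2] one gets
[(0, Q, Q, 0)], at [a3] [(0, 0, Q, 0)], at [a4] [(0, 0, 0, Q)].  Decompositions
add up over direct sums, so counting the objects in a list of representables
gives part (iii) in the form [cfg_free_decomp].

Generators as invariants.  The morphisms that are not isomorphisms kill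
exactly the complement of [Qi] in [P ai] for [i = 1, 2]; this gives
part (ii), see [gens_quot1], [gens_quot2], [gens_quot3] and [gens_bij4].

Projective modules.  If [P (+) P'] is free, put [Q1 = S_{a1} P],
[Q2 = S_{a2} P], [Q3 = coker f34] and [Q4 = P a4].  These functors commute with
direct sums, so part (ii) for [P (+) P'] shows that the [Qi] are summands of
free modules; the generators of [P (+) P'] also yield sections [Qi -> P ai].
That such sections generate [P] freely amounts to three statements about
kernels ([exactness]), which hold in any decomposed module and pass to direct
summands; so [P] is decomposed too ([decomp_summand]).  Conversely, given
complements of the [Pi] in free modules, the sum built from these complements,
enlarged by [E_{a3}] of a free module to meet the rank condition of (iii),
completes [P] to a free module. *)

(** * Linear maps, isomorphisms and quotients *)

Section LinearMaps.
Variable R : pzRingType.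
Implicit Types M N L : lmodType R.

Definition lin_of M N (f : M -> N) (fl : linear f) : {linear M -> N} :=
  HB.pack f (GRing.isLinear.Build R M N *:%R f fl).

Lemma linear_add M N (f g : M -> N) :
  linear f -> linear g -> linear (fun x => f x + g x).
Proof. by move=> fl gl a x y; rewrite fl gl scalerDr addrACA. Qed.

Lemma linear_inj_surj_bij M N (f : {linear M -> N}) :
  (forall x, f x = 0 -> x = 0) -> (forall y, exists x, y = f x) -> bijective f.
Proof.
move=> f_inj /choice[g fg]; exists g => [x|y]; last exact: esym (fg y).
apply: (raddf_inj f_inj); exact: esym (fg (f x)).
Qed.

Lemma linear_inverse M N (f : {linear M -> N}) :
  bijective f -> exists g : {linear N -> M}, cancel f g /\ cancel g f.
Proof.
case=> g fK gK.
have gl : linear g.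
  by move=> a x y; apply: (can_inj fK); rewrite linearP !gK.
by exists (lin_of gl).
Qed.

Lemma linear_inverse_family (I : Type) (M N : I -> lmodType R)
    (f : forall i, {linear M i -> N i}) :
  (forall i, bijective (f i)) -> exists g : forall i, {linear N i -> M i},
    (forall i, cancel (f i) (g i)) /\ (forall i, cancel (g i) (f i)).
Proof.
move=> f_bij; pose G i := cid (linear_inverse (f_bij i)).
by exists (fun i => sval (G i)); split=> i; case: (svalP (G i)).
Qed.

Lemma lmod_iso_refl M : lmod_iso M M.
Proof. by exists idfun; exists idfun. Qed.

Lemma lmod_iso_sym M N : lmod_iso M N -> lmod_iso N M.
Proof.
by case=> f /linear_inverse[g [fK gK]]; exists g; exists f.
Qed.

Lemma lmod_iso_trans M N L : lmod_iso M N -> lmod_iso N L -> lmod_iso M L.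
Proof.
case=> f f_bij [g g_bij]; exists (g \o f : {linear M -> L}).
exact: bij_comp.
Qed.

Section ProdMap.
Variables (M N M' N' : lmodType R).
Variables (f : {linear M -> N}) (g : {linear M' -> N'}).

Definition prod_map (x : M * M') : N * N' := (f x.1, g x.2).

Fact prod_map_linear : linear prod_map.
Proof. by move=> a x y; rewrite /prod_map /= !linearP. Qed.
HB.instance Definition _ :=
  GRing.isLinear.Build R (M * M')%type (N * N')%type *:%R
    prod_map prod_map_linear.

End ProdMap.

Lemma lmod_iso_prod M N M' N' :
  lmod_iso M N -> lmod_iso M' N' -> lmod_iso (M * M')%type (N * N')%type.
Proof.
move=> [f [f' fK f'K]] [g [g' gK g'K]]; exists (prod_map f g).
exists (fun y => (f' y.1, g' y.2)) => -[x y]; congr pair.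
- exact: fK.
- exact: gK.
- exact: f'K.
- exact: g'K.
Qed.

Lemma rV0_eq (v : 'rV[R]_0) : v = 0.
Proof. exact: thinmx0. Qed.

Lemma rV0_irr (v w : 'rV[R]_0) : v = w.
Proof. by rewrite (rV0_eq v) (rV0_eq w). Qed.

Lemma lmod_iso_prod0 M : lmod_iso (M * 'rV[R]_0)%type M.
Proof.
exists fst; exists (fun x => (x, 0)) => [[x y]|//].
by rewrite (rV0_eq y).
Qed.

Lemma lmod_iso_0prod M : lmod_iso ('rV[R]_0 * M)%type M.
Proof.
exists snd; exists (fun x => (0, x)) => [[y x]|//].
by rewrite (rV0_eq y).
Qed.

Lemma lmod_iso_prodA M N L :
  lmod_iso (M * (N * L))%type (M * N * L)%type.
Proof.
have fl : linear (fun x : M * (N * L) => (x.1, x.2.1, x.2.2)) by [].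
exists (lin_of fl); exists (fun x : M * N * L => (x.1.1, (x.1.2, x.2))) => /=.
  by case=> x [].
by case=> -[].
Qed.

Lemma lmod_iso_rV m n k : k = (m + n)%N ->
  lmod_iso ('rV[R]_m * 'rV[R]_n)%type 'rV[R]_k.
Proof.
move=> ->.
have fl : linear (fun x : 'rV[R]_m * 'rV[R]_n => row_mx x.1 x.2).
  by move=> a x y /=; rewrite scale_row_mx add_row_mx.
exists (lin_of fl); exists (fun v => (lsubmx v, rsubmx v)) => [[x y]|v] /=.
  by rewrite row_mxKl row_mxKr.
by rewrite hsubmxK.
Qed.

Lemma lmod_iso_regular : lmod_iso R^o 'rV[R]_1.
Proof.
have fl : linear (fun x : R^o => const_mx x : 'rV[R]_1).
  by move=> a x y; apply/rowP => i; rewrite !mxE.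
exists (lin_of fl); exists (fun v : 'rV_1 => v 0 0) => [x|v] /=.
  by rewrite mxE.
by apply/rowP => i; rewrite mxE ord1.
Qed.

Lemma fg_free_rV n : fg_free 'rV[R]_n.
Proof. by exists n; exact: lmod_iso_refl. Qed.

End LinearMaps.

Section Quotients.
Variable R : pzRingType.

Lemma lquot_pi_eq0 (M : lmodType R) (A : set M) x :
  lquot_pi A x = 0 <-> lspan A x.
Proof.
rewrite -(linear0 (lquot_pi A)) (rwP eqP) lquot_pi_eq subr0.
by split=> /asboolP.
Qed.

Lemma lspan_kernel (M N : lmodType R) (A : set M) (f : {linear M -> N}) :
  (forall x, A x -> f x = 0) -> forall x, lspan A x -> f x = 0.
Proof.
move=> Af x; elim=> [y /Af//||a y z _ fy _ fz]; first exact: linear0.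
by rewrite linearP fy fz scaler0 addr0.
Qed.

Lemma lspan_map (M N : lmodType R) (A : set M) (B : set N)
    (f : {linear M -> N}) :
  (forall x, A x -> lspan B (f x)) -> forall x, lspan A x -> lspan B (f x).
Proof.
move=> fAB x; elim=> [y /fAB//||a y z _ sy _ sz].
  by rewrite linear0; exact: lspan0.
by rewrite linearP; exact: lspan_lin.
Qed.

Lemma lspanD (M : lmodType R) (A : set M) x y :
  lspan A x -> lspan A y -> lspan A (x + y).
Proof. by move=> sx sy; rewrite -(scale1r x); exact: lspan_lin. Qed.

Lemma lspan_range (M N : lmodType R) (f : {linear M -> N}) x :
  lspan (range f) x -> range f x.
Proof.
elim=> [//||a y z _ [y' _ <-] _ [z' _ <-]].
  by exists 0 => //; rewrite linear0.
by exists (a *: y' + z') => //; rewrite linearP.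
Qed.

(** The universal property of the quotient. *)
Lemma lquot_lift (M N : lmodType R) (A : set M) (f : {linear M -> N}) :
  (forall x, A x -> f x = 0) ->
  exists g : {linear lquot A -> N}, forall x, g (lquot_pi A x) = f x.
Proof.
move=> Af; pose g (q : lquot A) := f (repr q).
have gE x : g (lquot_pi A x) = f x.
  apply/eqP; rewrite -subr_eq0 -linearB; apply/eqP.
  apply: (lspan_kernel Af); apply/lquot_pi_eq0.
  by rewrite linearB /= lquot_pi_repr subrr.
have gl : linear g.
  move=> a p q; rewrite -(lquot_pi_repr p) -(lquot_pi_repr q) -linearP.
  by rewrite !gE linearP.
by exists (lin_of gl).
Qed.

(** The hypotheses hold for relation sets that are defined by images of maps,
because the zero vector always belongs to such an image. *)
Lemma lspan_prod (M M' : lmodType R) (A : set M) (A' : set M')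
    (B : set (M * M')%type) :
  (forall w, B w -> A w.1 /\ A' w.2) ->
  (forall v, A v -> B (v, 0)) -> (forall v, A' v -> B (0, v)) ->
  forall w, lspan B w <-> lspan A w.1 /\ lspan A' w.2.
Proof.
move=> BA AB AB' w; split=> [|[s1 s2]].
  elim=> [x /BA[Ax Ax']||a x y _ [? ?] _ [? ?]].
  - by split; exact: lspan_sub.
  - by split; exact: lspan0.
  - by split; exact: lspan_lin.
have il : linear (fun x : M => (x, 0 : M')).
  by move=> a x y; congr pair; rewrite /= scaler0 addr0.
have ir : linear (fun x : M' => (0 : M, x)).
  by move=> a x y; congr pair; rewrite /= scaler0 addr0.
have -> : w = (w.1, 0) + (0, w.2) :> M * M'.
  by case: w {s1 s2} => x y; congr pair; rewrite /= ?addr0 ?add0r.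
apply: lspanD.
  by apply: (@lspan_map _ _ A B (lin_of il)) s1 => x /AB; exact: lspan_sub.
by apply: (@lspan_map _ _ A' B (lin_of ir)) s2 => x /AB'; exact: lspan_sub.
Qed.

(** The two quotients are summands of [F]; including the first one in [F],
then applying [t] and projecting to [M] splits the quotient map.  That the
section takes its values among the first components of [t] lets it inherit
the equations that [t] satisfies. *)
Lemma lquot_prod_split (M M' F : lmodType R) (A : set M) (A' : set M')
    (B : set (M * M')%type) (t : {linear F -> (M * M')%type}) :
  (forall w, B w -> A w.1 /\ A' w.2) ->
  (forall v, A v -> B (v, 0)) -> (forall v, A' v -> B (0, v)) ->
  bijective (lquot_pi B \o t) ->
  lmod_iso (lquot A * lquot A')%type F /\
  exists2 s : {linear lquot A -> M},
    cancel s (lquot_pi A) & forall x, exists q, s x = (t q).1.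
Proof.
move=> BA AB AB' t_bij.
pose f : {linear F -> (lquot A * lquot A')%type} :=
  prod_map (lquot_pi A) (lquot_pi A') \o t.
have spanE := lspan_prod BA AB AB'.
have f_bij : bijective f.
  apply: linear_inj_surj_bij => [x [/lquot_pi_eq0 s1 /lquot_pi_eq0 s2]|[p p']].
    apply: (bij_inj t_bij); rewrite linear0 /=.
    by apply/lquot_pi_eq0/spanE.
  case: t_bij => g _ gK; exists (g (lquot_pi B (repr p, repr p'))).
  have /eqP := gK (lquot_pi B (repr p, repr p')).
  rewrite /= -subr_eq0 -linearB /= => /eqP/lquot_pi_eq0/spanE[].
  move=> /lquot_pi_eq0 /= /eqP + /lquot_pi_eq0 /= /eqP.
  rewrite !linearB !subr_eq0 /= !lquot_pi_repr => /eqP e1 /eqP e2.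
  by congr pair; exact: esym.
have [g [fK gK]] := linear_inverse f_bij.
split; first by exists g; exists f.
have sl : linear (fun x : lquot A => (t (g (x, 0))).1).
  move=> a x y.
  have -> : (a *: x + y, 0) = a *: (x, 0) + (y, 0) :> lquot A * lquot A'.
    by congr pair; rewrite /= scaler0 addr0.
  by rewrite !linearP.
exists (lin_of sl) => [x|x] /=; last by exists (g (x, 0)).
by have := gK (x, 0); rewrite /f /= => -[].
Qed.

End Quotients.

(** * Coordinates on free modules and on tensor products with free modules *)

Section FreeCoordinates.
Variables (R : pzRingType) (T : choiceType).

Definition freemod_coef (t : T) (w : freemod R T) : R^o := w t.

Fact freemod_coef_linear t : linear (freemod_coef t).
Proof. by []. Qed.
HB.instance Definition _ t := GRing.isLinear.Build R
  (freemod R T) R^o *:%R (freemod_coef t) (freemod_coef_linear t).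

Lemma freemod_coef_basis s t : freemod_coef s (fbasis R t) = (s == t)%:R.
Proof. by []. Qed.

Lemma freemod_expand (r : seq T) (w : freemod R T) :
  uniq r -> (forall t, t \in r) ->
  w = \sum_(t <- r) (freemod_coef t w : R) *: fbasis R t.
Proof.
move=> r_uniq r_full; apply/val_inj/funext => s.
rewrite -[LHS]/(freemod_coef s w) -[RHS]/(freemod_coef s _) linear_sum /=.
rewrite (bigD1_seq s) //= big1 ?addr0 => [|t ts].
  by rewrite -[RHS]/(freemod_coef s w * (s == s)%:R) eqxx mulr1.
by rewrite -[LHS]/(freemod_coef t w * (s == t)%:R) eq_sym (negPf ts) mulr0.
Qed.

End FreeCoordinates.

Section TensorCoordinates.
Variables (R : comPzRingType) (Q : lmodType R).

Definition pure (M : lmodType R) (q : Q) (m : M) : tensor Q M :=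
  lquot_pi _ (fbasis R (q, m)).

Lemma pureDl (M : lmodType R) q q' (m : M) :
  pure (q + q') m = pure q m + pure q' m.
Proof.
rewrite /pure -linearD /=; apply/eqP; rewrite lquot_pi_eq.
by apply/asboolP/lspan_sub/tensor_relDl.
Qed.

Lemma pureDr (M : lmodType R) q (m m' : M) :
  pure q (m + m') = pure q m + pure q m'.
Proof.
rewrite /pure -linearD /=; apply/eqP; rewrite lquot_pi_eq.
by apply/asboolP/lspan_sub/tensor_relDr.
Qed.

Lemma pureZl (M : lmodType R) a q (m : M) : pure (a *: q) m = a *: pure q m.
Proof.
rewrite /pure -linearZ /=; apply/eqP; rewrite lquot_pi_eq.
by apply/asboolP/lspan_sub/tensor_relZl.
Qed.

Lemma pureZr (M : lmodType R) a q (m : M) : pure q (a *: m) = a *: pure q m.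
Proof.
rewrite /pure -linearZ /=; apply/eqP; rewrite lquot_pi_eq.
by apply/asboolP/lspan_sub/tensor_relZr.
Qed.

Lemma pure_linear (M : lmodType R) (m : M) : linear (fun q => pure q m).
Proof. by move=> a q q'; rewrite pureDl pureZl. Qed.

Lemma tensor_ext (M N : lmodType R) (f g : {linear tensor Q M -> N}) :
  (forall q m, f (pure q m) = g (pure q m)) -> f =1 g.
Proof.
move=> fg z; rewrite -(lquot_pi_repr z).
apply: (@freemod_ext R _ N (f \o lquot_pi _) (g \o lquot_pi _)) => -[q m].
exact: fg.
Qed.

Lemma tensor_map_pure (M N : lmodType R) (g : {linear M -> N}) q m :
  tensor_map g (pure q m) = pure q (g m).
Proof. by rewrite /pure tensor_map_pi tensor_pre_basis. Qed.

Variable T : choiceType.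

(** The [t]-th coordinate of [Q (x) R^(T)], which is the direct sum of the
copies of [Q] indexed by [T]. *)
Lemma tensor_coef (t : T) : exists c : {linear tensor Q (freemod R T) -> Q},
  forall q m, c (pure q m) = freemod_coef t m *: q.
Proof.
pose f : {linear freemod R (Q * freemod R T)%type -> Q} :=
  lin_ext (fun x => freemod_coef t x.2 *: x.1).
have fE q m : f (fbasis R (q, m)) = freemod_coef t m *: q.
  exact: lin_ext_basis.
suff /lquot_lift[c cE] : forall x, @tensor_rel R Q (freemod R T) x -> f x = 0.
  by exists c => q m; rewrite /pure cE fE.
move=> _ [q q' m|q m m'|a q m|a q m]; rewrite linearB /=.
- by rewrite [f (_ + _)]linearD /= !fE scalerDr subrr.
- by rewrite [f (_ + _)]linearD /= !fE linearD scalerDl subrr.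
- by rewrite [f (_ *: _)]linearZ /= !fE !scalerA mulrC subrr.
- by rewrite [f (_ *: _)]linearZ /= !fE linearZ /= scalerA subrr.
Qed.

End TensorCoordinates.

(** * Modules free on an [R]-module at one object *)

(** The morphism sets carry no finite type structure, and their equality is the
classical one, so they are listed by hand. *)
Definition enumA (x y : objA) : seq (morA x y) :=
  match x, y return seq (morA x y) with
  | a1, a1 => [:: id1; f11]
  | a1, a2 => [:: f12; g12]
  | a1, a3 => [:: f13]
  | a1, a4 => [:: f14]
  | a2, a1 => [:: f21; g21]
  | a2, a2 => [:: id2; f22]
  | a2, a3 => [:: f23]
  | a2, a4 => [:: f24; g24]
  | a3, a1 => [:: f31]
  | a3, a2 => [:: f32]
  | a3, a3 => [:: id3]
  | a3, a4 => [:: f34]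
  | a4, a4 => [:: id4]
  | a4, _ => [::]
  end.

Lemma mem_enumA x y (u : morA x y) : u \in enumA x y.
Proof. by case: u; rewrite /= !inE ?eqxx ?orbT. Qed.

Lemma morA_neq :
  ((id1 == f11) = false) * ((f11 == id1) = false) *
  ((f12 == g12) = false) * ((g12 == f12) = false) *
  ((f21 == g21) = false) * ((g21 == f21) = false) *
  ((id2 == f22) = false) * ((f22 == id2) = false) *
  ((f24 == g24) = false) * ((g24 == f24) = false).
Proof. by do !split; apply/eqP; discriminate. Qed.

Lemma enumA_uniq x y : uniq (enumA x y).
Proof. by case: x; case: y; rewrite //= inE morA_neq. Qed.

Local Notation act P u := (@cact _ catAA P _ _ u).

(** This covers the representable modules and the functors [E_x(Q)] at once:
[M] is the direct sum of copies of [Q] indexed by the morphisms to [x], with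
coordinates [c] and with [e] the copy at the identity. *)
Definition free_on (R : pzRingType) (x : objA) (Q : lmodType R)
    (M : cmodule R catAA) : Prop :=
  exists (e : {linear Q -> M x}) (c : forall y, morA y x -> {linear M y -> Q}),
    (forall y (u v : morA y x) q,
      c y u (act M v (e q)) = if u == v then q else 0)
    /\ (forall y z, z = \sum_(u <- enumA y x) act M u (e (c y u z))).

Lemma rmor_free_on (R : pzRingType) x :
  @free_on R x R^o (rmor R (x : catAA)).
Proof.
have el : linear (fun q : R^o => (q : R) *: fbasis R (idA x)).
  by move=> a p q; rewrite scalerDl scalerA.
have actE y (v : morA y x) q :
    act (rmor R (x : catAA)) v (lin_of el q) = (q : R) *: fbasis R v.
  rewrite linearZ /=; congr (_ *: _).
  by rewrite /rmor_act lin_ext_basis mor_comp_idl.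
exists (lin_of el), (fun y u => @freemod_coef R (morA y x) u); split.
  move=> y u v q; rewrite actE -[LHS]/(q * (u == v)%:R).
  by case: eqP => _; rewrite ?mulr1 ?mulr0.
move=> y z; under eq_bigr do rewrite actE.
by apply: freemod_expand; [exact: enumA_uniq|exact: mem_enumA].
Qed.

Lemma E_free_on (R : comPzRingType) x (Q : lmodType R) :
  free_on x Q (E_ (x : catAA) Q).
Proof.
pose e := lin_of (@pure_linear R Q _ (fbasis R (idA x))).
pose c y (u : morA y x) := sval (cid (@tensor_coef R Q (morA y x) u)).
have cE y (u : morA y x) q m : c y u (pure q m) = freemod_coef u m *: q.
  by rewrite /c; case: cid.
have actE y (v : morA y x) q :
    act (E_ (x : catAA) Q) v (e q) = pure q (fbasis R v).
  apply: etrans (tensor_map_pure _ _ _) _ => /=.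
  by rewrite /rmor_act lin_ext_basis mor_comp_idl.
exists e, c; split=> [y u v q|y z].
  rewrite actE cE freemod_coef_basis.
  by case: eqP => _; rewrite ?scale1r ?scale0r.
under eq_bigr do rewrite actE.
pose i u := lin_of (@pure_linear R Q _ (fbasis R (u : morA y x))).
have sl : linear (fun z => \sum_(u <- enumA y x) i u (c y u z)).
  move=> a z1 z2; rewrite scaler_sumr -big_split.
  by apply: eq_bigr => u _; rewrite !linearP.
apply: (tensor_ext (f := idfun) (g := lin_of sl)) => q m /=.
rewrite [in LHS](freemod_expand m (enumA_uniq y x) (@mem_enumA y x)).
rewrite (big_morph _ (pureDr q) (_ : pure q 0 = 0)); last first.
  by rewrite -(scale0r 0) pureZr scale0r.
by apply: eq_bigr => u _; rewrite cE pureZr pureZl.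
Qed.

(** * Adapted generators *)

(** Every morphism of the category is a composite of [f13], [f23], [f31],
[f32], [f34], [g12], [g21], [g24].  Rewriting with these equations brings any
action to a normal form in these generators; they include [a3] being a retract
of [a1] and [a2]. *)
Lemma act_rel (R : pzRingType) (P : cmodule R catAA) :
  (forall v, act P id1 v = v) * (forall v, act P id2 v = v) *
  (forall v, act P id3 v = v) * (forall v, act P id4 v = v) *
  (forall v, act P f31 (act P f13 v) = v) *
  (forall v, act P f32 (act P f23 v) = v) *
  (forall v, act P f31 (act P g12 v) = act P f32 v) *
  (forall v, act P f32 (act P g21 v) = act P f31 v) *
  (forall v, act P f32 (act P g24 v) = act P f34 v) *
  (forall v, act P g12 (act P g21 v) = act P f13 (act P f31 v)) *
  (forall v, act P g21 (act P g12 v) = act P f23 (act P f32 v)) *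
  (forall v, act P g12 (act P g24 v) = act P f13 (act P f34 v)) *
  (forall v, act P g12 (act P f23 v) = act P f13 v) *
  (forall v, act P g21 (act P f13 v) = act P f23 v) *
  (forall v, act P f11 v = act P f13 (act P f31 v)) *
  (forall v, act P f12 v = act P f13 (act P f32 v)) *
  (forall v, act P f14 v = act P f13 (act P f34 v)) *
  (forall v, act P f21 v = act P f23 (act P f31 v)) *
  (forall v, act P f22 v = act P f23 (act P f32 v)) *
  (forall v, act P f24 v = act P f23 (act P f34 v)).
Proof.
have act1 x v : act P (idA x) v = v := @cact1 _ _ P x v.
have actM x y z (q : morA y z) (p : morA x y) v :
  act P p (act P q v) = act P (compAA q p) v by rewrite -cactM.
do !split; move=> v; rewrite ?actM //=; exact: act1.
Qed.

Section AdaptedGenerators.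
Variables (R : pzRingType) (P : cmodule R catAA).

(* The difference is given by its equation only: were it transparent, rewriting
with additivity would match inside it. *)
Fact diff24_subproof : {h : {linear P a4 -> P a2} |
  forall v, h v = act P g24 v - act P f23 (act P f34 v)}.
Proof. by exists (act P g24 \- act P f24) => v /=; rewrite !act_rel. Qed.

Definition diff24 : {linear P a4 -> P a2} := sval diff24_subproof.

Lemma diff24E v : diff24 v = act P g24 v - act P f23 (act P f34 v).
Proof. exact: svalP diff24_subproof v. Qed.

Lemma f32_diff24 v : act P f32 (diff24 v) = 0.
Proof. by rewrite diff24E linearB !act_rel subrr. Qed.

Lemma g12_diff24 v : act P g12 (diff24 v) = 0.
Proof. by rewrite diff24E linearB !act_rel subrr. Qed.

(** The direct sum decompositions of [ker f31], [ker f32], [P a3] and [P a4]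
described at the beginning, each written as surjectivity and trivial kernel. *)
Record gens (Q1 Q2 Q3 Q4 : lmodType R)
    (s1 : {linear Q1 -> P a1}) (s2 : {linear Q2 -> P a2})
    (s3 : {linear Q3 -> P a3}) (s4 : {linear Q4 -> P a4}) : Prop := Gens {
  gens_ker1 : forall q, act P f31 (s1 q) = 0;
  gens_ker2 : forall q, act P f32 (s2 q) = 0;
  gens_onto1 : forall v, act P f31 v = 0 ->
    exists q1 q2, v = s1 q1 + act P g12 (s2 q2);
  gens_inj1 : forall q1 q2, s1 q1 + act P g12 (s2 q2) = 0 -> q1 = 0 /\ q2 = 0;
  gens_onto2 : forall v, act P f32 v = 0 ->
    exists q1 q2 q4, v = act P g21 (s1 q1) + s2 q2 + diff24 (s4 q4);
  gens_inj2 : forall q1 q2 q4, act P g21 (s1 q1) + s2 q2 + diff24 (s4 q4) = 0 ->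
    [/\ q1 = 0, q2 = 0 & q4 = 0];
  gens_onto3 : forall v, exists q3 q4, v = s3 q3 + act P f34 (s4 q4);
  gens_inj3 : forall q3 q4, s3 q3 + act P f34 (s4 q4) = 0 -> q3 = 0 /\ q4 = 0;
  gens_onto4 : forall v, exists q4, v = s4 q4 }.

Definition decomp (Q1 Q2 Q3 Q4 : lmodType R) : Prop :=
  exists (s1 : {linear Q1 -> P a1}) (s2 : {linear Q2 -> P a2})
    (s3 : {linear Q3 -> P a3}) (s4 : {linear Q4 -> P a4}), gens s1 s2 s3 s4.

Section Assemble.
Variables (Q1 Q2 Q3 Q4 : lmodType R).
Variables (s1 : {linear Q1 -> P a1}) (s2 : {linear Q2 -> P a2}).
Variables (s3 : {linear Q3 -> P a3}) (s4 : {linear Q4 -> P a4}).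
Hypothesis sP : gens s1 s2 s3 s4.

Lemma gens_onto_a1 v : exists q1 q2 p,
  v = s1 q1 + act P g12 (s2 q2) + act P f13 p.
Proof.
have [|q1 [q2 vE]] := gens_onto1 sP (v := v - act P f13 (act P f31 v)).
  by rewrite linearB !act_rel subrr.
by exists q1, q2, (act P f31 v); rewrite -vE subrK.
Qed.

Lemma gens_onto_a2 v : exists q1 q2 q4 p,
  v = act P g21 (s1 q1) + s2 q2 + diff24 (s4 q4) + act P f23 p.
Proof.
have [|q1 [q2 [q4 vE]]] := gens_onto2 sP (v := v - act P f23 (act P f32 v)).
  by rewrite linearB !act_rel subrr.
by exists q1, q2, q4, (act P f32 v); rewrite -vE subrK.
Qed.

Lemma f31_gens q1 q2 p :
  act P f31 (s1 q1 + act P g12 (s2 q2) + act P f13 p) = p.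
Proof.
by rewrite !linearD !act_rel (gens_ker1 sP) (gens_ker2 sP) !add0r.
Qed.

Lemma f32_gens q1 q2 q4 p :
  act P f32 (act P g21 (s1 q1) + s2 q2 + diff24 (s4 q4) + act P f23 p) = p.
Proof.
rewrite !linearD f32_diff24 !act_rel (gens_ker1 sP) (gens_ker2 sP).
by rewrite !add0r.
Qed.

Lemma gens_inj_a1 q1 q2 p :
  s1 q1 + act P g12 (s2 q2) + act P f13 p = 0 -> [/\ q1 = 0, q2 = 0 & p = 0].
Proof.
move=> e; have p0 : p = 0 by rewrite -(f31_gens q1 q2 p) e linear0.
by move: e; rewrite p0 linear0 addr0 => /(gens_inj1 sP)[].
Qed.

Lemma gens_inj_a2 q1 q2 q4 p :
  act P g21 (s1 q1) + s2 q2 + diff24 (s4 q4) + act P f23 p = 0 ->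
  [/\ q1 = 0, q2 = 0, q4 = 0 & p = 0].
Proof.
move=> e; have p0 : p = 0 by rewrite -(f32_gens q1 q2 q4 p) e linear0.
by move: e; rewrite p0 linear0 addr0 => /(gens_inj2 sP)[].
Qed.

(** What [K_1(Q1) (+) K_2(Q2) (+) E_{a3}(Q3) (+) E_{a4}(Q4)] looks like at
each object once tensor products and zero summands are removed. *)
Definition model (x : objA) : lmodType R :=
  match x with
  | a1 => (Q1 * Q2 * (Q3 * Q4))%type
  | a2 => (Q1 * Q2 * Q4 * (Q3 * Q4))%type
  | a3 => (Q3 * Q4)%type
  | a4 => Q4
  end.

Definition assemble3 (q : Q3 * Q4) : P a3 := s3 q.1 + act P f34 (s4 q.2).

Definition assemble (x : objA) : model x -> P x :=
  match x with
  | a1 => fun q =>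
    s1 q.1.1 + act P g12 (s2 q.1.2) + act P f13 (assemble3 q.2)
  | a2 => fun q => act P g21 (s1 q.1.1.1) + s2 q.1.1.2 + diff24 (s4 q.1.2)
    + act P f23 (assemble3 q.2)
  | a3 => assemble3
  | a4 => s4
  end.

Lemma assemble3_linear : linear assemble3.
Proof. by apply: linear_add => a p q; rewrite /= !linearP. Qed.

Lemma assemble_linear x : linear (@assemble x).
Proof.
have a3l (V W : lmodType R) (f : {linear P a3 -> W})
    (g : {linear V -> (Q3 * Q4)%type}) :
    linear (fun v => f (assemble3 (g v))).
  by move=> a p q; rewrite linearP assemble3_linear linearP.
case: x => /=.
- apply: linear_add (a3l _ _ (act P f13) snd).
  by apply: linear_add => a p q; rewrite /= !linearP.
- apply: linear_add (a3l _ _ (act P f23) snd).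
  apply: linear_add; [apply: linear_add|] => a p q; by rewrite /= !linearP.
- exact: assemble3_linear.
- exact: linearP.
Qed.

Lemma assemble_bij x : bijective (@assemble x).
Proof.
apply: (linear_inj_surj_bij (f := lin_of (@assemble_linear x))).
  case: x => /=.
  - case=> -[q1 q2] [q3 q4] /= /gens_inj_a1[-> -> /(gens_inj3 sP)[] /= -> ->].
    by [].
  - case=> -[[q1 q2] q4] [q3 q4'] /=.
    by move=> /gens_inj_a2[-> -> -> /(gens_inj3 sP)[] /= -> ->].
  - by case=> q3 q4 /(gens_inj3 sP)[] /= -> ->.
  - move=> q4 /= e; have [] // := gens_inj3 sP (q3 := 0) (q4 := q4).
    by rewrite linear0 e linear0 addr0.
case: x => v /=.
- have [q1 [q2 [p ->]]] := gens_onto_a1 v.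
  by have [q3 [q4 ->]] := gens_onto3 sP p; exists (q1, q2, (q3, q4)).
- have [q1 [q2 [q4 [p ->]]]] := gens_onto_a2 v.
  by have [q3 [q4' ->]] := gens_onto3 sP p; exists (q1, q2, q4, (q3, q4')).
- by have [q3 [q4 ->]] := gens_onto3 sP v; exists (q3, q4).
- exact: gens_onto4 sP v.
Qed.

(** Every [f_ij] factors through [a3]; this is its first factor. *)
Definition model_out (y : objA) : model y -> Q3 * Q4 :=
  match y with
  | a1 => fun q => q.2
  | a2 => fun q => q.2
  | a3 => fun q => q
  | a4 => fun q => (0, q)
  end.

Definition model_act x y (u : morA x y) : model y -> model x :=
  match u in morA x y return model y -> model x with
  | id1 | id2 | id3 | id4 => fun q => q
  | f11 | f12 | f13 | f14 => fun q => (0, 0, model_out q)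
  | f21 | f22 | f23 | f24 => fun q => (0, 0, 0, model_out q)
  | f31 | f32 | f34 => fun q => model_out q
  | g12 => fun q => (0, q.1.1.2, q.2)
  | g21 => fun q => (q.1.1, 0, 0, q.2)
  | g24 => fun q => (0, 0, q, (0, q))
  end.

Lemma assemble_act x y (u : morA x y) q :
  assemble (model_act u q) = act P u (assemble q).
Proof.
case: u q => q; rewrite /= /assemble3 /= ?linear0 ?add0r ?addr0 ?act_rel //.
all: rewrite ?linearD ?act_rel ?f32_diff24 ?g12_diff24.
all: rewrite ?(gens_ker1 sP) ?(gens_ker2 sP) ?linear0 ?add0r ?addr0.
all: by rewrite ?diff24E ?subrK.
Qed.

End Assemble.

End AdaptedGenerators.

(** * Modules with a decomposition *)

Lemma cmod_iso_sym (R : pzRingType) (C : category) (M N : cmodule R C) :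
  cmod_iso M N -> cmod_iso N M.
Proof.
case=> f [f_bij f_nat].
have [g [fK gK]] := linear_inverse_family f_bij.
exists g; split=> [x|x y u v]; first exact: Bijective (gK x) (fK x).
by apply: (can_inj (fK x)); rewrite f_nat !gK.
Qed.

Section Decompositions.
Variable R : pzRingType.
Implicit Types (P : cmodule R catAA) (Q : lmodType R).

(** The model and the operators on it depend on the generating modules only,
and [assemble] is a natural bijection from it. *)
Lemma decomp_unique P P' Q1 Q2 Q3 Q4 :
  decomp P Q1 Q2 Q3 Q4 -> decomp P' Q1 Q2 Q3 Q4 -> cmod_iso P P'.
Proof.
move=> [s1 [s2 [s3 [s4 sP]]]] [t1 [t2 [t3 [t4 tP]]]].
pose F (x : objA) := lin_of (@assemble_linear _ P _ _ _ _ s1 s2 s3 s4 x).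
pose F' (x : objA) := lin_of (@assemble_linear _ P' _ _ _ _ t1 t2 t3 t4 x).
have F_bij x : bijective (F x) := assemble_bij sP x.
have F'_bij x : bijective (F' x) := assemble_bij tP x.
have [G [FK GK]] := linear_inverse_family F_bij.
exists (fun x => F' x \o G x : {linear P x -> P' x}); split=> [x|x y u v].
  exact: bij_comp (F'_bij x) (Bijective (GK x) (FK x)).
rewrite -[in LHS](GK y v) /= -(assemble_act tP) -(assemble_act sP).
by rewrite -[X in G x X]/(F x _) FK.
Qed.

Lemma decomp_cmod_iso P P' Q1 Q2 Q3 Q4 :
  cmod_iso P P' -> decomp P Q1 Q2 Q3 Q4 -> decomp P' Q1 Q2 Q3 Q4.
Proof.
move=> [f [f_bij f_nat]] [s1 [s2 [s3 [s4 sP]]]].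
have actE x y (u : morA x y) v : act P' u (f y v) = f x (act P u v).
  by rewrite f_nat.
have diffE v : diff24 P' (f a4 v) = f a2 (diff24 P v).
  by rewrite !diff24E !actE linearB.
have f_inj x v : f x v = 0 -> v = 0.
  by rewrite -(linear0 (f x)) => /(bij_inj (f_bij x)).
have f_onto x v : exists w, v = f x w.
  by case: (f_bij x) => g _ gK; exists (g v); rewrite gK.
exists (f a1 \o s1 : {linear Q1 -> P' a1}), (f a2 \o s2 : {linear Q2 -> P' a2}).
exists (f a3 \o s3 : {linear Q3 -> P' a3}), (f a4 \o s4 : {linear Q4 -> P' a4}).
split=> /=.
- by move=> q; rewrite actE (gens_ker1 sP) linear0.
- by move=> q; rewrite actE (gens_ker2 sP) linear0.
- move=> v; have [w ->] := f_onto _ v; rewrite actE => /f_inj.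
  move=> /(gens_onto1 sP)[q1 [q2 ->]]; exists q1, q2.
  by rewrite actE linearD.
- move=> q1 q2; rewrite actE -linearD => /f_inj; exact: gens_inj1 sP _ _.
- move=> v; have [w ->] := f_onto _ v; rewrite actE => /f_inj.
  move=> /(gens_onto2 sP)[q1 [q2 [q4 ->]]]; exists q1, q2, q4.
  by rewrite actE diffE !linearD.
- move=> q1 q2 q4; rewrite actE diffE -!linearD => /f_inj.
  exact: gens_inj2 sP _ _ _.
- move=> v; have [w ->] := f_onto _ v.
  have [q3 [q4 ->]] := gens_onto3 sP w; exists q3, q4.
  by rewrite actE linearD.
- move=> q3 q4; rewrite actE -linearD => /f_inj; exact: gens_inj3 sP _ _.
- move=> v; have [w ->] := f_onto _ v.
  by have [q4 ->] := gens_onto4 sP w; exists q4.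
Qed.

Lemma decomp_lmod_iso P Q1 Q2 Q3 Q4 Q1' Q2' Q3' Q4' :
  lmod_iso Q1 Q1' -> lmod_iso Q2 Q2' -> lmod_iso Q3 Q3' -> lmod_iso Q4 Q4' ->
  decomp P Q1 Q2 Q3 Q4 -> decomp P Q1' Q2' Q3' Q4'.
Proof.
move=> /lmod_iso_sym[f1 f1_bij] /lmod_iso_sym[f2 f2_bij].
move=> /lmod_iso_sym[f3 f3_bij] /lmod_iso_sym[f4 f4_bij].
move=> [s1 [s2 [s3 [s4 sP]]]].
have inj0 (M N : lmodType R) (f : {linear M -> N}) :
    bijective f -> forall v, f v = 0 -> v = 0.
  by move=> f_bij v; rewrite -(linear0 f) => /(bij_inj f_bij).
have onto (M N : lmodType R) (f : {linear M -> N}) :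
    bijective f -> forall v, exists w, v = f w.
  by case=> g _ gK v; exists (g v); rewrite gK.
exists (s1 \o f1 : {linear Q1' -> P a1}), (s2 \o f2 : {linear Q2' -> P a2}).
exists (s3 \o f3 : {linear Q3' -> P a3}), (s4 \o f4 : {linear Q4' -> P a4}).
split=> /=.
- by move=> q; exact: gens_ker1 sP _.
- by move=> q; exact: gens_ker2 sP _.
- move=> v /(gens_onto1 sP)[q1 [q2 ->]].
  have [q1' ->] := onto _ _ _ f1_bij q1; have [q2' ->] := onto _ _ _ f2_bij q2.
  by exists q1', q2'.
- by move=> q1 q2 /(gens_inj1 sP)[/(inj0 _ _ _ f1_bij) ? /(inj0 _ _ _ f2_bij)].
- move=> v /(gens_onto2 sP)[q1 [q2 [q4 ->]]].
  have [q1' ->] := onto _ _ _ f1_bij q1; have [q2' ->] := onto _ _ _ f2_bij q2.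
  by have [q4' ->] := onto _ _ _ f4_bij q4; exists q1', q2', q4'.
- move=> q1 q2 q4 /(gens_inj2 sP)[].
  by move=> /(inj0 _ _ _ f1_bij) ? /(inj0 _ _ _ f2_bij) ? /(inj0 _ _ _ f4_bij).
- move=> v; have [q3 [q4 ->]] := gens_onto3 sP v.
  have [q3' ->] := onto _ _ _ f3_bij q3; have [q4' ->] := onto _ _ _ f4_bij q4.
  by exists q3', q4'.
- by move=> q3 q4 /(gens_inj3 sP)[/(inj0 _ _ _ f3_bij) ? /(inj0 _ _ _ f4_bij)].
- move=> v; have [q4 ->] := gens_onto4 sP v.
  by have [q4' ->] := onto _ _ _ f4_bij q4; exists q4'.
Qed.

Lemma diff24_dsum P P' v :
  diff24 (dsum P P') v = (diff24 P v.1, diff24 P' v.2).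
Proof. by rewrite diff24E !diff24E. Qed.

Lemma decomp_dsum P P' Q1 Q2 Q3 Q4 Q1' Q2' Q3' Q4' :
  decomp P Q1 Q2 Q3 Q4 -> decomp P' Q1' Q2' Q3' Q4' ->
  decomp (dsum P P') (Q1 * Q1')%type (Q2 * Q2')%type (Q3 * Q3')%type
    (Q4 * Q4')%type.
Proof.
move=> [s1 [s2 [s3 [s4 sP]]]] [t1 [t2 [t3 [t4 tP]]]].
exists (prod_map s1 t1), (prod_map s2 t2), (prod_map s3 t3), (prod_map s4 t4).
split.
- by move=> q; congr pair; [exact: gens_ker1 sP _|exact: gens_ker1 tP _].
- by move=> q; congr pair; [exact: gens_ker2 sP _|exact: gens_ker2 tP _].
- case=> v v' [/(gens_onto1 sP)[q1 [q2 ->]] /(gens_onto1 tP)[q1' [q2' ->]]].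
  by exists (q1, q1'), (q2, q2').
- case=> q1 q1' [q2 q2'] [/(gens_inj1 sP)[/= -> ->] /(gens_inj1 tP)[/= -> ->]].
  by [].
- case=> v v' [/(gens_onto2 sP)[q1 [q2 [q4 ->]]]].
  case/(gens_onto2 tP)=> q1' [q2' [q4' ->]].
  by exists (q1, q1'), (q2, q2'), (q4, q4'); rewrite diff24_dsum.
- case=> q1 q1' [q2 q2'] [q4 q4']; rewrite diff24_dsum.
  by case=> /(gens_inj2 sP)[/= -> -> ->] /(gens_inj2 tP)[/= -> -> ->].
- case=> v v'; have [q3 [q4 ->]] := gens_onto3 sP v.
  by have [q3' [q4' ->]] := gens_onto3 tP v'; exists (q3, q3'), (q4, q4').
- case=> q3 q3' [q4 q4'] [/(gens_inj3 sP)[/= -> ->] /(gens_inj3 tP)[/= -> ->]].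
  by [].
- case=> v v'; have [q4 ->] := gens_onto4 sP v.
  by have [q4' ->] := gens_onto4 tP v'; exists (q4, q4').
Qed.

Local Notation O := 'rV[R]_0.

Lemma K1_decomp Q : decomp (K1_ Q) Q O O O.
Proof.
exists idfun, \0, \0, \0; split=> //=.
- by move=> v _; exists v, 0; rewrite addr0.
- by move=> q1 q2; rewrite addr0 (rV0_eq q2).
- by move=> v _; exists v, 0, 0; rewrite linear0 !addr0.
- by move=> q1 q2 q4; rewrite linear0 !addr0 (rV0_eq q2) (rV0_eq q4).
- by move=> v; exists 0, 0; exact: rV0_irr.
- by move=> q3 q4 _; rewrite (rV0_eq q3) (rV0_eq q4).
- by move=> v; exists 0; exact: rV0_irr.
Qed.

Lemma K2_decomp Q : decomp (K2_ Q) O Q O O.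
Proof.
exists \0, idfun, \0, \0; split=> //=.
- by move=> v _; exists 0, v; rewrite add0r.
- by move=> q1 q2; rewrite add0r (rV0_eq q1).
- by move=> v _; exists 0, v, 0; rewrite linear0 addr0 add0r.
- by move=> q1 q2 q4; rewrite linear0 addr0 add0r (rV0_eq q1) (rV0_eq q4).
- by move=> v; exists 0, 0; exact: rV0_irr.
- by move=> q3 q4 _; rewrite (rV0_eq q3) (rV0_eq q4).
- by move=> v; exists 0; exact: rV0_irr.
Qed.

Lemma czero_decomp : decomp (czero R catAA) O O O O.
Proof.
exists \0, \0, \0, \0; split=> //=; do ?[move=> v; exact: rV0_irr].
- by move=> v _; exists 0, 0; rewrite (rV0_eq v) addr0.
- by move=> q1 q2 _; rewrite (rV0_eq q1) (rV0_eq q2).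
- by move=> v _; exists 0, 0, 0; rewrite (rV0_eq v) linear0 !addr0.
- by move=> q1 q2 q4 _; rewrite (rV0_eq q1) (rV0_eq q2) (rV0_eq q4).
- by move=> v; exists 0, 0; rewrite (rV0_eq v) addr0.
- by move=> q3 q4 _; rewrite (rV0_eq q3) (rV0_eq q4).
- by move=> v; exists 0; rewrite (rV0_eq v).
Qed.

End Decompositions.

Section FreeOnDecomp.
Variables (R : pzRingType) (Q : lmodType R) (M : cmodule R catAA).

Local Notation O := 'rV[R]_0.

(** Here and at [a2] the generator at the object must be corrected by an
[f_ii] to lie in the kernel; what is subtracted comes from [a3], so the same
module [Q] reappears there as a third generator. *)
Lemma free_on_a1_decomp : free_on a1 Q M -> decomp M Q O Q O.
Proof.
case=> e [c [cE cX]].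
have [s1 s1E] : exists s1 : {linear Q -> M a1},
    forall q, s1 q = act M id1 (e q) - act M f11 (e q).
  by exists (e \- (act M f11 \o e)) => q; rewrite act_rel.
have g21s1 q : act M g21 (s1 q) = act M g21 (e q) - act M f21 (e q).
  by rewrite s1E linearB !act_rel.
exists s1, \0, (act M f31 \o e : {linear Q -> M a3}), \0; split.
- by move=> q; rewrite s1E linearB !act_rel subrr.
- by move=> q; rewrite linear0.
- move=> v; rewrite (cX _ v) !big_cons big_nil /= addr0.
  rewrite linearD !act_rel => /addr0_eq e0; exists (c _ id1 v), 0.
  by rewrite !linear0 addr0 s1E !act_rel -e0 linearN.
- move=> q1 q2; rewrite !linear0 addr0 (rV0_eq q2) s1E => e0; split=> //.
  by have := linear0 (c _ id1); rewrite -e0 linearB !cE !morA_neq eqxx subr0.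
- move=> v; rewrite (cX _ v) !big_cons big_nil /= addr0.
  rewrite linearD !act_rel => /addr0_eq e0; exists (c _ g21 v), 0, 0.
  by rewrite !linear0 !addr0 g21s1 !act_rel -e0 linearN opprK addrC.
- move=> q1 q2 q4; rewrite !linear0 !addr0 (rV0_eq q2) (rV0_eq q4) g21s1 => e0.
  split=> //.
  by have := linear0 (c _ g21); rewrite -e0 linearB !cE !morA_neq eqxx subr0.
- move=> v; exists (c _ f31 v), 0.
  by rewrite !linear0 addr0 {1}(cX _ v) big_cons big_nil addr0.
- move=> q3 q4; rewrite !linear0 addr0 (rV0_eq q4) /= => e0; split=> //.
  by have := linear0 (c _ f31); rewrite -e0 cE eqxx.
- by move=> v; exists 0; rewrite (cX _ v) big_nil.
Qed.

Lemma free_on_a2_decomp : free_on a2 Q M -> decomp M O Q Q O.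
Proof.
case=> e [c [cE cX]].
have [s2 s2E] : exists s2 : {linear Q -> M a2},
    forall q, s2 q = act M id2 (e q) - act M f22 (e q).
  by exists (e \- (act M f22 \o e)) => q; rewrite act_rel.
have g12s2 q : act M g12 (s2 q) = act M g12 (e q) - act M f12 (e q).
  by rewrite s2E linearB !act_rel.
exists \0, s2, (act M f32 \o e : {linear Q -> M a3}), \0; split.
- by move=> q; rewrite linear0.
- by move=> q; rewrite s2E linearB !act_rel subrr.
- move=> v; rewrite (cX _ v) !big_cons big_nil /= addr0.
  rewrite linearD !act_rel => /addr0_eq e0; exists 0, (c _ g12 v).
  by rewrite add0r g12s2 !act_rel -e0 linearN opprK addrC.
- move=> q1 q2; rewrite add0r (rV0_eq q1) g12s2 => e0; split=> //.
  by have := linear0 (c _ g12); rewrite -e0 linearB !cE !morA_neq eqxx subr0.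
- move=> v; rewrite (cX _ v) !big_cons big_nil /= addr0.
  rewrite linearD !act_rel => /addr0_eq e0; exists 0, (c _ id2 v), 0.
  by rewrite !linear0 add0r addr0 s2E !act_rel -e0 linearN.
- move=> q1 q2 q4; rewrite !linear0 add0r addr0 (rV0_eq q1) (rV0_eq q4) s2E.
  move=> e0; split=> //.
  by have := linear0 (c _ id2); rewrite -e0 linearB !cE !morA_neq eqxx subr0.
- move=> v; exists (c _ f32 v), 0.
  by rewrite !linear0 addr0 {1}(cX _ v) big_cons big_nil addr0.
- move=> q3 q4; rewrite !linear0 addr0 (rV0_eq q4) /= => e0; split=> //.
  by have := linear0 (c _ f32); rewrite -e0 cE eqxx.
- by move=> v; exists 0; rewrite (cX _ v) big_nil.
Qed.

Lemma free_on_a3_decomp : free_on a3 Q M -> decomp M O O Q O.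
Proof.
case=> e [c [cE cX]]; exists \0, \0, e, \0; split.
- by move=> q; rewrite linear0.
- by move=> q; rewrite linear0.
- move=> v; rewrite (cX _ v) big_cons big_nil addr0 act_rel => ->.
  by exists 0, 0; rewrite !linear0 addr0.
- by move=> q1 q2 _; rewrite (rV0_eq q1) (rV0_eq q2).
- move=> v; rewrite (cX _ v) big_cons big_nil addr0 act_rel => ->.
  by exists 0, 0, 0; rewrite !linear0 !addr0.
- by move=> q1 q2 q4 _; rewrite (rV0_eq q1) (rV0_eq q2) (rV0_eq q4).
- move=> v; exists (c _ id3 v), 0.
  by rewrite !linear0 addr0 {1}(cX _ v) big_cons big_nil addr0 act_rel.
- move=> q3 q4; rewrite !linear0 addr0 (rV0_eq q4) => e0; split=> //.
  by have := cE _ id3 id3 q3; rewrite act_rel e0 linear0 eqxx.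
- by move=> v; exists 0; rewrite (cX _ v) big_nil.
Qed.

Lemma free_on_a4_decomp : free_on a4 Q M -> decomp M O O O Q.
Proof.
case=> e [c [cE cX]].
have diffE q : diff24 M (e q) = act M g24 (e q) - act M f24 (e q).
  by rewrite diff24E act_rel.
exists \0, \0, \0, e; split.
- by move=> q; rewrite linear0.
- by move=> q; rewrite linear0.
- move=> v; rewrite (cX _ v) big_cons big_nil addr0 !act_rel => ->.
  by exists 0, 0; rewrite !linear0 addr0.
- by move=> q1 q2 _; rewrite (rV0_eq q1) (rV0_eq q2).
- move=> v; rewrite (cX _ v) !big_cons big_nil /= addr0.
  rewrite linearD !act_rel => /addr0_eq e0; exists 0, 0, (c _ g24 v).
  by rewrite !linear0 !add0r diffE !act_rel -e0 linearN opprK addrC.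
- move=> q1 q2 q4; rewrite !linear0 !add0r (rV0_eq q1) (rV0_eq q2) diffE.
  move=> e0; split=> //.
  by have := linear0 (c _ g24); rewrite -e0 linearB !cE !morA_neq eqxx subr0.
- move=> v; exists 0, (c _ f34 v).
  by rewrite add0r {1}(cX _ v) big_cons big_nil addr0.
- move=> q3 q4; rewrite add0r (rV0_eq q3) => e0; split=> //.
  by have := cE _ f34 f34 q4; rewrite e0 linear0 eqxx.
- move=> v; exists (c _ id4 v).
  by rewrite {1}(cX _ v) big_cons big_nil addr0 act_rel.
Qed.

End FreeOnDecomp.

Section Classification.
Variable R : comPzRingType.
Implicit Types (P : cmodule R catAA) (Q : lmodType R).

Lemma KKEE_decomp Q1 Q2 Q3 Q4 : decomp (KKEE Q1 Q2 Q3 Q4) Q1 Q2 Q3 Q4.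
Proof.
have := decomp_dsum (decomp_dsum (decomp_dsum (K1_decomp Q1) (K2_decomp Q2))
  (free_on_a3_decomp (E_free_on a3 Q3))) (free_on_a4_decomp (E_free_on a4 Q4)).
have r0 (M N : lmodType R) : lmod_iso M N -> lmod_iso (M * 'rV[R]_0)%type N.
  by apply: lmod_iso_trans; exact: lmod_iso_prod0.
have l0 (M N : lmodType R) : lmod_iso M 'rV[R]_0 -> lmod_iso (M * N)%type N.
  move=> M0; apply: lmod_iso_trans (lmod_iso_0prod N).
  exact: lmod_iso_prod M0 (lmod_iso_refl N).
apply: decomp_lmod_iso.
- by do 3!apply: (r0); exact: lmod_iso_refl.
- by do 2!apply: (r0); apply: (l0); exact: lmod_iso_refl.
- by apply: (r0); apply: (l0); apply: (r0); exact: lmod_iso_refl.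
- by apply: (l0); do 2!apply: (r0); exact: lmod_iso_refl.
Qed.

Lemma cmod_iso_KKEE P Q1 Q2 Q3 Q4 :
  cmod_iso P (KKEE Q1 Q2 Q3 Q4) <-> decomp P Q1 Q2 Q3 Q4.
Proof.
split=> [/cmod_iso_sym PE|dP].
  exact: decomp_cmod_iso PE (KKEE_decomp _ _ _ _).
exact: decomp_unique dP (KKEE_decomp _ _ _ _).
Qed.

End Classification.

(** * Free modules *)

Section FreeModules.
Variable R : pzRingType.

Definition at_obj (x y : objA) : nat :=
  match x, y with
  | a1, a1 | a2, a2 | a3, a3 | a4, a4 => 1
  | _, _ => 0
  end.

Definition mult (x : objA) (s : seq objA) : nat := \sum_(y <- s) at_obj x y.

Definition free_module (s : seq objA) : cmodule R catAA :=
  foldr (fun x : catAA => dsum (rmor R x)) (czero R catAA) s.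

(** The four decompositions of representables in one formula; the third rank
counts [a1] and [a2] as well, which is where [F1 (+) F2 (+) F3] comes from. *)
Lemma rmor_decomp (x : objA) :
  decomp (rmor R (x : catAA)) 'rV_(at_obj a1 x) 'rV_(at_obj a2 x)
    'rV_(at_obj a1 x + at_obj a2 x + at_obj a3 x) 'rV_(at_obj a4 x).
Proof.
have O_iso := lmod_iso_refl 'rV[R]_0; have I_iso := lmod_iso_regular R.
have := rmor_free_on R x; case: x.
- by move/free_on_a1_decomp; exact: decomp_lmod_iso.
- by move/free_on_a2_decomp; exact: decomp_lmod_iso.
- by move/free_on_a3_decomp; exact: decomp_lmod_iso.
- by move/free_on_a4_decomp; exact: decomp_lmod_iso.
Qed.

Lemma free_module_decomp (s : seq objA) :
  decomp (free_module s) 'rV_(mult a1 s) 'rV_(mult a2 s)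
    'rV_(mult a1 s + mult a2 s + mult a3 s) 'rV_(mult a4 s).
Proof.
elim: s => [|x s IHs]; first by rewrite /mult !big_nil; exact: czero_decomp.
apply: decomp_lmod_iso (decomp_dsum (rmor_decomp x) IHs);
  apply: lmod_iso_rV; rewrite /mult !big_cons //.
by rewrite [in RHS]addnACA; congr (_ + _)%N; rewrite addnACA.
Qed.

Lemma mult_surj n1 n2 n3 n4 : exists s,
  [/\ mult a1 s = n1, mult a2 s = n2, mult a3 s = n3 & mult a4 s = n4].
Proof.
exists (nseq n1 a1 ++ nseq n2 a2 ++ nseq n3 a3 ++ nseq n4 a4).
have multE x : mult x (nseq n1 a1 ++ nseq n2 a2 ++ nseq n3 a3 ++ nseq n4 a4) =
    (at_obj x a1 * n1 + (at_obj x a2 * n2 +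
      (at_obj x a3 * n3 + at_obj x a4 * n4)))%N.
  by rewrite /mult !big_cat !big_nseq /= !iter_addn_0.
by rewrite !multE /= !mul0n !mul1n !addn0 !add0n.
Qed.

End FreeModules.

(** * Recovering the generators *)

Lemma mor_id_iso (C : category) (x : C) : is_iso (mor_id x).
Proof. by exists (mor_id x); rewrite !mor_comp_idl. Qed.

Section Radical.
Variables (R : pzRingType) (P : cmodule R catAA).

(** The submodule spanned by this set is the one divided out in [S_ P x]. *)
Definition rad (x : objA) : set (P x) :=
  [set v | exists (y : catAA) (u : mor (x : catAA) y),
    ~ is_iso u /\ range (cact P u) v].

Lemma g12_nonisoA : ~ @is_iso catAA a1 a2 g12.
Proof.
case=> v [+ _]; have := mem_enumA v; rewrite !inE.
by case/orP=> /eqP ->.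
Qed.

Lemma f13_nonisoA : ~ @is_iso catAA a1 a3 f13.
Proof. by case=> v [+ _]; have := mem_enumA v; rewrite !inE => ->. Qed.

Lemma g21_nonisoA : ~ @is_iso catAA a2 a1 g21.
Proof.
case=> v [+ _]; have := mem_enumA v; rewrite !inE.
by case/orP=> /eqP ->.
Qed.

Lemma f23_nonisoA : ~ @is_iso catAA a2 a3 f23.
Proof. by case=> v [+ _]; have := mem_enumA v; rewrite !inE => ->. Qed.

Lemma nonisoA_a4 x (u : morA x a4) : x <> a4 -> ~ @is_iso catAA x a4 u.
Proof. by case: x u => // u _ [v _]; have := mem_enumA v. Qed.

Lemma lspan_rad x (y : objA) (u : morA x y) v :
  ~ @is_iso catAA x y u -> lspan (@rad x) (act P u v).
Proof. by move=> u_noniso; apply: lspan_sub; exists y, u; split. Qed.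

(** The images of [f11], [f12] and [f14] lie in the image of [f13]. *)
Lemma rad_a1P v :
  lspan (@rad a1) v <-> exists w p, v = act P g12 w + act P f13 p.
Proof.
split=> [|[w [p ->]]]; last first.
  by apply: lspanD; apply: lspan_rad; [exact: g12_nonisoA|exact: f13_nonisoA].
elim=> [{}v [y [u [+ [x _ <-]]]]||a v1 v2 _ [w1 [p1 ->]] _ [w2 [p2 ->]]].
- move: y u x; apply: morA_ind1 => x niso.
  + by case: niso; exact: mor_id_iso.
  + by exists 0, (act P f31 x); rewrite linear0 add0r act_rel.
  + by exists 0, (act P f32 x); rewrite linear0 add0r act_rel.
  + by exists x, 0; rewrite linear0 addr0.
  + by exists 0, x; rewrite linear0 add0r.
  + by exists 0, (act P f34 x); rewrite linear0 add0r act_rel.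
- by exists 0, 0; rewrite !linear0 addr0.
- by exists (a *: w1 + w2), (a *: p1 + p2); rewrite !linearP scalerDr addrACA.
Qed.

(** Replacing the image of [g24] by the one of the difference is harmless, as
the image of [f24] lies in the image of [f23]. *)
Lemma rad_a2P v : lspan (@rad a2) v <->
  exists w x p, v = act P g21 w + diff24 P x + act P f23 p.
Proof.
split=> [|[w [x [p ->]]]]; last first.
  apply: lspanD; last by apply: lspan_rad; exact: f23_nonisoA.
  apply: lspanD; first by apply: lspan_rad; exact: g21_nonisoA.
  have -> : diff24 P x = -1 *: act P f24 x + act P g24 x.
    by rewrite diff24E act_rel scaleN1r addrC.
  by apply: lspan_lin; apply: lspan_rad; exact: nonisoA_a4.
elim=> [{}v [y [u [+ [x _ <-]]]]||].
- move: y u x; apply: morA_ind2 => x niso.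
  + by exists 0, 0, (act P f31 x); rewrite !linear0 !add0r act_rel.
  + by exists x, 0, 0; rewrite !linear0 !addr0.
  + by case: niso; exact: mor_id_iso.
  + by exists 0, 0, (act P f32 x); rewrite !linear0 !add0r act_rel.
  + by exists 0, 0, x; rewrite !linear0 !add0r.
  + by exists 0, 0, (act P f34 x); rewrite !linear0 !add0r act_rel.
  + by exists 0, x, (act P f34 x); rewrite linear0 add0r diff24E subrK.
- by exists 0, 0, 0; rewrite !linear0 !addr0.
move=> a v1 v2 _ [w1 [x1 [p1 ->]]] _ [w2 [x2 [p2 ->]]].
exists (a *: w1 + w2), (a *: x1 + x2), (a *: p1 + p2).
by rewrite !linearP !scalerDr addrACA; congr (_ + _); rewrite addrACA.
Qed.

End Radical.

Section GeneratorsAsQuotients.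
Variables (R : pzRingType) (P : cmodule R catAA) (Q1 Q2 Q3 Q4 : lmodType R).
Variables (s1 : {linear Q1 -> P a1}) (s2 : {linear Q2 -> P a2}).
Variables (s3 : {linear Q3 -> P a3}) (s4 : {linear Q4 -> P a4}).
Hypothesis sP : gens s1 s2 s3 s4.

Lemma g12_gens q1 q2 x p :
  act P g12 (act P g21 (s1 q1) + s2 q2 + diff24 P x + act P f23 p) =
  act P g12 (s2 q2) + act P f13 p.
Proof.
by rewrite !linearD g12_diff24 !act_rel (gens_ker1 sP) linear0 add0r addr0.
Qed.

Lemma g21_gens q1 q2 p :
  act P g21 (s1 q1 + act P g12 (s2 q2) + act P f13 p) =
  act P g21 (s1 q1) + act P f23 p.
Proof. by rewrite !linearD !act_rel (gens_ker2 sP) linear0 addr0. Qed.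

(** In [P a1 = Q1 (+) g12 Q2 (+) f13 (P a3)] the last two summands are the span
of the images of non-isomorphisms. *)
Lemma gens_quot1 : bijective (lquot_pi (@rad _ P a1) \o s1).
Proof.
apply: linear_inj_surj_bij => [q /= /lquot_pi_eq0/rad_a1P[w [p]]|v].
  have [q1 [q2 [q4 [p' ->]]]] := gens_onto_a2 sP w; rewrite g12_gens.
  rewrite -addrA -linearD => e.
  have [//|->//] := @gens_inj_a1 _ _ _ _ _ _ _ _ _ _ sP q (- q2) (- (p' + p)).
  by rewrite !linearN e addrAC addrK subrr.
have [q1 [q2 [p e]]] := gens_onto_a1 sP (repr v); exists q1.
rewrite -[LHS]lquot_pi_repr e -addrA linearD /=.
suff /lquot_pi_eq0-> : lspan (@rad _ P a1) (act P g12 (s2 q2) + act P f13 p).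
  by rewrite addr0.
by apply/rad_a1P; exists (s2 q2), p.
Qed.

(** In [P a2 = g21 Q1 (+) Q2 (+) (g24 - f24) Q4 (+) f23 (P a3)] all summands but
the second one come from non-isomorphisms, and they exhaust the images. *)
Lemma gens_quot2 : bijective (lquot_pi (@rad _ P a2) \o s2).
Proof.
apply: linear_inj_surj_bij => [q /= /lquot_pi_eq0/rad_a2P[w [x [p]]]|v].
  have [q1 [q2 [p' ->]]] := gens_onto_a1 sP w; rewrite g21_gens.
  have [q4 ->] := gens_onto4 sP x.
  rewrite [_ + diff24 _ _]addrAC -[X in _ = X -> _]addrA -linearD => e.
  have [|_ -> //] :=
    @gens_inj_a2 _ _ _ _ _ _ _ _ _ _ sP (- q1) q (- q4) (- (p' + p)).
  rewrite !linearN e -[X in - _ + X]addrA addKr.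
  by rewrite [X in X - _]addrC addKr subrr.
have [q1 [q2 [q4 [p e]]]] := gens_onto_a2 sP (repr v); exists q2.
rewrite -[LHS]lquot_pi_repr e [act P g21 _ + _]addrC -!addrA linearD /=.
suff /lquot_pi_eq0-> : lspan (@rad _ P a2)
    (act P g21 (s1 q1) + (diff24 P (s4 q4) + act P f23 p)).
  by rewrite addr0.
by apply/rad_a2P; exists (s1 q1), (s4 q4), p; rewrite addrA.
Qed.

Lemma gens_quot3 : bijective (lquot_pi (range (act P f34)) \o s3).
Proof.
apply: linear_inj_surj_bij => [q /= /lquot_pi_eq0/lspan_range[x _]|v].
  have [q4 ->] := gens_onto4 sP x => e.
  have [|->//] := @gens_inj3 _ _ _ _ _ _ _ _ _ _ sP q (- q4).
  by rewrite !linearN e subrr.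
have [q3 [q4 e]] := gens_onto3 sP (repr v); exists q3.
rewrite -[LHS]lquot_pi_repr e linearD /=.
suff /lquot_pi_eq0-> : lspan (range (act P f34)) (act P f34 (s4 q4)).
  by rewrite addr0.
by apply: lspan_sub; exists (s4 q4).
Qed.

Lemma gens_bij4 : bijective s4.
Proof.
apply: linear_inj_surj_bij => [q e|v]; last exact: gens_onto4 sP v.
have [|_ //] := @gens_inj3 _ _ _ _ _ _ _ _ _ _ sP 0 q.
by rewrite e !linear0 addr0.
Qed.

End GeneratorsAsQuotients.

(** * Direct summands *)

Section Exactness.
Variable R : pzRingType.
Implicit Types P : cmodule R catAA.

(** The kernel conditions that make chosen lifts of generators independent.
They do not mention generators, which is why they pass to summands. *)
Record exactness P : Prop := {
  exact_g12 : forall v, act P g12 v = 0 -> lspan (@rad _ P a2) v;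
  exact_g21 : forall v x p, act P g21 v + diff24 P x + act P f23 p = 0 ->
    lspan (@rad _ P a1) v /\ x = 0;
  exact_f34 : forall x, act P f34 x = 0 -> x = 0 }.

Lemma decomp_exact P (Q1 Q2 Q3 Q4 : lmodType R) :
  decomp P Q1 Q2 Q3 Q4 -> exactness P.
Proof.
move=> [s1 [s2 [s3 [s4 sP]]]]; split=> [v|v x p|x].
- have [q1 [q2 [q4 [p ->]]]] := gens_onto_a2 sP v.
  rewrite (g12_gens sP) => e.
  have [|_ -> _] := @gens_inj_a1 _ _ _ _ _ _ _ _ _ _ sP 0 q2 p.
    by rewrite linear0 add0r.
  by apply/rad_a2P; exists (s1 q1), (s4 q4), p; rewrite linear0 addr0.
- have [q1 [q2 [p' ->]]] := gens_onto_a1 sP v; rewrite (g21_gens sP).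
  have [q4 ->] := gens_onto4 sP x.
  rewrite [_ + diff24 _ _]addrAC -[X in X = _ -> _]addrA -linearD => e.
  have [|-> _ -> _] := @gens_inj_a2 _ _ _ _ _ _ _ _ _ _ sP q1 0 q4 (p' + p).
    by rewrite linear0 addr0.
  split; last exact: linear0.
  by apply/rad_a1P; exists (s2 q2), p'; rewrite linear0 add0r.
- have [q4 ->] := gens_onto4 sP x => e.
  have [|_ ->] := @gens_inj3 _ _ _ _ _ _ _ _ _ _ sP 0 q4.
    by rewrite e linear0 addr0.
  exact: linear0.
Qed.

Lemma rad_dsumP P P' x :
  [/\ forall w, @rad _ (dsum P P') x w -> @rad _ P x w.1 /\ @rad _ P' x w.2,
      forall v, @rad _ P x v -> @rad _ (dsum P P') x (v, 0)
    & forall v, @rad _ P' x v -> @rad _ (dsum P P') x (0, v)].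
Proof.
split=> [_ [y [u [niso [[w1 w2] _ <-]]]]|_ [y [u [niso [w _ <-]]]]|].
- by split; exists y, u.
- exists y, u; split=> //; exists (w, 0) => //.
  by congr pair; exact: linear0.
- move=> _ [y [u [niso [w _ <-]]]].
  exists y, u; split=> //; exists (0, w) => //.
  by congr pair; exact: linear0.
Qed.

(** A relation in [P] is a relation in [P (+) P'] with second components zero,
and spans are computed componentwise. *)
Lemma exact_summand P P' : exactness (dsum P P') -> exactness P.
Proof.
case=> e12 e21 e34.
have spanE x (w : dsum P P' x) : lspan (@rad _ (dsum P P') x) w ->
    lspan (@rad _ P x) w.1.
  by have [H1 H2 H3] := rad_dsumP P P' x => /(lspan_prod H1 H2 H3)[].
split=> [v e|v x p e|x e].
- apply: (spanE a2 (v, 0)); apply: e12.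
  by congr pair; [exact: e|exact: linear0].
- have [|/spanE ? /(congr1 fst)] := e21 (v, 0) (x, 0) (p, 0).
    rewrite diff24_dsum; congr pair; first exact: e.
    by rewrite /= !linear0 !addr0.
  by [].
- suff /e34/(congr1 fst) : act (dsum P P') f34 (x, 0) = 0 by [].
  by congr pair; [exact: e|exact: linear0].
Qed.

Lemma lspan_lquot_section (M : lmodType R) (A : set M)
    (s : {linear lquot A -> M}) v :
  cancel s (lquot_pi A) -> lspan A (v - s (lquot_pi A v)).
Proof. by move=> sK; apply/lquot_pi_eq0; rewrite linearB /= sK subrr. Qed.

(** Subtracting from [v] the lift of its class leaves an element of the span of
images.  Doing this at [a1] and then at [a2] (or in the other order) reaches
the required sum: a second round would pass through [g12 g21] or [g21 g12],
which factor through [a3], and for [v] in [ker f31] or [ker f32] the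
contributions of [a3] add up to zero. *)
Lemma exact_gens P (s1 : {linear S_ P (a1 : catAA) -> P a1})
    (s2 : {linear S_ P (a2 : catAA) -> P a2})
    (s3 : {linear coker (act P f34) -> P a3}) :
  exactness P ->
  cancel s1 (lquot_pi (@rad _ P a1)) -> cancel s2 (lquot_pi (@rad _ P a2)) ->
  cancel s3 (lquot_pi (range (act P f34))) ->
  (forall q, act P f31 (s1 q) = 0) -> (forall q, act P f32 (s2 q) = 0) ->
  gens s1 s2 s3 (idfun : {linear P a4 -> P a4}).
Proof.
move=> [e12 e21 e34] s1K s2K s3K k1 k2.
have split1 v : exists q1 w p, v = s1 q1 + act P g12 w + act P f13 p.
  have /rad_a1P[w [p e]] := lspan_lquot_section v s1K.
  by exists (lquot_pi _ v), w, p; rewrite -addrA -e addrC subrK.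
have split2 v : exists q2 w x p,
    v = s2 q2 + (act P g21 w + diff24 P x + act P f23 p).
  have /rad_a2P[w [x [p e]]] := lspan_lquot_section v s2K.
  by exists (lquot_pi _ v), w, x, p; rewrite -e addrC subrK.
have pi1 w p : lquot_pi (@rad _ P a1) (act P g12 w + act P f13 p) = 0.
  by apply/lquot_pi_eq0/rad_a1P; exists w, p.
have pi2 w x : lquot_pi (@rad _ P a2) (act P g21 w + diff24 P x) = 0.
  by apply/lquot_pi_eq0/rad_a2P; exists w, x, 0; rewrite linear0 addr0.
have drop1 u p : act P f31 (u + act P f13 p) = 0 -> act P f31 u = 0 ->
    u + act P f13 p = u.
  rewrite linearD act_rel => + u0; rewrite u0 add0r => ->.
  by rewrite linear0 addr0.
have drop2 u p : act P f32 (u + act P f23 p) = 0 -> act P f32 u = 0 ->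
    u + act P f23 p = u.
  rewrite linearD act_rel => + u0; rewrite u0 add0r => ->.
  by rewrite linear0 addr0.
split=> //.
- move=> v; have [q1 [w [p ->]]] := split1 v.
  have [q2 [w' [x [p' ->]]]] := split2 w.
  have -> : act P g12 (s2 q2 + (act P g21 w' + diff24 P x + act P f23 p')) =
      act P g12 (s2 q2) + act P f13 (act P f31 w' + p').
    by rewrite !linearD g12_diff24 !act_rel addr0.
  rewrite [s1 q1 + _]addrA -[_ + act P f13 p]addrA -linearD => /drop1 ->.
    by exists q1, q2.
  by rewrite linearD act_rel k1 k2 addr0.
- move=> q1 q2 e.
  have q10 : q1 = 0.
    have pi0 := pi1 (s2 q2) 0; rewrite linear0 addr0 in pi0.
    move: e => /(congr1 (lquot_pi (@rad _ P a1))).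
    by rewrite linearD linear0 /= pi0 addr0 s1K.
  split=> //; move: e; rewrite q10 linear0 add0r => /e12/lquot_pi_eq0.
  by rewrite s2K.
- move=> v; have [q2 [w [x [p ->]]]] := split2 v.
  have [q1 [w' [p' ->]]] := split1 w.
  have -> : act P g21 (s1 q1 + act P g12 w' + act P f13 p') =
      act P g21 (s1 q1) + act P f23 (act P f32 w' + p').
    by rewrite !linearD !act_rel addrA.
  rewrite [_ + diff24 _ _]addrAC -[_ + _ + act P f23 p]addrA -linearD.
  rewrite [s2 q2 + _]addrA [s2 q2 + _]addrA [s2 q2 + _]addrC.
  move=> /drop2 ->; first by exists q1, q2, x.
  by rewrite !linearD !act_rel f32_diff24 k1 k2 !addr0.
- move=> q1 q2 q4 e.
  have q20 : q2 = 0.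
    move: e; rewrite addrAC => /(congr1 (lquot_pi (@rad _ P a2))).
    by rewrite linearD linear0 /= pi2 add0r s2K.
  have [|/lquot_pi_eq0] := e21 (s1 q1) q4 0.
    by rewrite -e q20 !linear0 !addr0.
  by rewrite s1K.
- move=> v; have /lspan_range[x _ e] := lspan_lquot_section v s3K.
  by exists (lquot_pi _ v), x; rewrite /= e addrC subrK.
- move=> q3 q4 /= e.
  have q30 : q3 = 0.
    move: e => /(congr1 (lquot_pi (range (act P f34)))).
    rewrite linearD linear0 /= s3K.
    suff /lquot_pi_eq0-> : lspan (range (act P f34)) (act P f34 q4).
      by rewrite addr0.
    by apply: lspan_sub; exists q4.
  by split=> //; apply: e34; rewrite -e q30 linear0 add0r.
- by move=> v; exists v.
Qed.

(** All four functors turn [P (+) P'] into a direct sum, so the generators of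
[P (+) P'] provide both the complements and the lifts that [exact_gens]
needs. *)
Lemma decomp_summand P P' (F1 F2 F3 F4 : lmodType R) :
  decomp (dsum P P') F1 F2 F3 F4 ->
  decomp P (S_ P (a1 : catAA)) (S_ P (a2 : catAA)) (coker (act P f34)) (P a4) /\
  [/\ lmod_iso (S_ P (a1 : catAA) * S_ P' (a1 : catAA))%type F1,
      lmod_iso (S_ P (a2 : catAA) * S_ P' (a2 : catAA))%type F2,
      lmod_iso (coker (act P f34) * coker (act P' f34))%type F3
    & lmod_iso (P a4 * P' a4)%type F4].
Proof.
move=> dD; have [t1 [t2 [t3 [t4 tD]]]] := dD.
have [H1 H2 H3] := rad_dsumP P P' a1.
have [i1 [s1 s1K s1t]] := lquot_prod_split H1 H2 H3 (gens_quot1 tD).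
have [H4 H5 H6] := rad_dsumP P P' a2.
have [i2 [s2 s2K s2t]] := lquot_prod_split H4 H5 H6 (gens_quot2 tD).
have H7 w : range (act (dsum P P') f34) w ->
    range (act P f34) w.1 /\ range (act P' f34) w.2.
  by case=> -[x x'] _ <-; split; [exists x|exists x'].
have H8 v : range (act P f34) v -> range (act (dsum P P') f34) (v, 0).
  by case=> x _ <-; exists (x, 0) => //; congr pair; exact: linear0.
have H9 v : range (act P' f34) v -> range (act (dsum P P') f34) (0, v).
  by case=> x _ <-; exists (0, x) => //; congr pair; exact: linear0.
have [i3 [s3 s3K _]] := lquot_prod_split H7 H8 H9 (gens_quot3 tD).
split; last first.
  by split=> //; apply: lmod_iso_sym; exists t4; exact: gens_bij4 tD.
exists s1, s2, s3, idfun; apply: exact_gens => //.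
- exact: exact_summand (decomp_exact dD).
- by move=> q; have [q' ->] := s1t q; have /(congr1 fst) := gens_ker1 tD q'.
- by move=> q; have [q' ->] := s2t q; have /(congr1 fst) := gens_ker2 tD q'.
Qed.

End Exactness.

Lemma fg_free_projective (R : pzRingType) (M N F : lmodType R) :
  lmod_iso (M * N)%type F -> fg_free F -> fg_projective M.
Proof. by move=> MN Ff; exists N, F. Qed.

Lemma cfg_free_decomp (R : pzRingType) (P : cmodule R catAA) :
  cfg_free P <-> exists n1 n2 n3 n4 : nat,
    decomp P 'rV[R]_n1 'rV[R]_n2 'rV[R]_(n1 + n2 + n3) 'rV[R]_n4.
Proof.
split=> [[s Ps]|[n1 [n2 [n3 [n4 dP]]]]].
  exists (mult a1 s), (mult a2 s), (mult a3 s), (mult a4 s).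
  exact: decomp_cmod_iso (cmod_iso_sym Ps) (free_module_decomp R s).
have [s [e1 e2 e3 e4]] := mult_surj n1 n2 n3 n4.
exists s; apply: decomp_unique dP _.
by have := free_module_decomp R s; rewrite e1 e2 e3 e4.
Qed.

(** * The classification of projective and free modules *)

Theorem theorem10p5 (R : comPzRingType) (P : cmodule R catAA) :
  (cfg_projective P <->
    exists P1 P2 P3 P4 : lmodType R,
      [/\ fg_projective P1, fg_projective P2, fg_projective P3
        & fg_projective P4] /\
      cmod_iso P (KKEE P1 P2 P3 P4)) /\
  (forall P1 P2 P3 P4 : lmodType R,
    fg_projective P1 -> fg_projective P2 -> fg_projective P3 ->
    fg_projective P4 ->
    cmod_iso P (KKEE P1 P2 P3 P4) ->
    [/\ lmod_iso P1 (S_ P (a1 : catAA)),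
        lmod_iso P2 (S_ P (a2 : catAA)),
        lmod_iso P3 (coker (cact P (f34 : mor (a3 : catAA) (a4 : catAA))))
      & lmod_iso P4 (P (a4 : catAA))]) /\
  (cfg_free P <->
    exists F1 F2 F3 F4 : lmodType R,
      [/\ fg_free F1, fg_free F2, fg_free F3 & fg_free F4] /\
      cmod_iso P (KKEE F1 F2 (F1 * F2 * F3)%type F4)).
Proof.
split; [split|split; [|split]].
- case=> P' [F [/cfg_free_decomp[n1 [n2 [n3 [n4 dF]]]] PF]].
  have [dP [i1 i2 i3 i4]] :=
    decomp_summand (decomp_cmod_iso (cmod_iso_sym PF) dF).
  exists (S_ P (a1 : catAA)), (S_ P (a2 : catAA)), (coker (act P f34)), (P a4).
  split; last exact/cmod_iso_KKEE.
  split.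
  + exact: fg_free_projective i1 (fg_free_rV _ _).
  + exact: fg_free_projective i2 (fg_free_rV _ _).
  + exact: fg_free_projective i3 (fg_free_rV _ _).
  + exact: fg_free_projective i4 (fg_free_rV _ _).
- case=> P1 [P2 [P3 [P4 [[p1 p2 p3 p4] /cmod_iso_KKEE dP]]]].
  case: p1 => P1' [F1 [[n1 f1] i1]]; case: p2 => P2' [F2 [[n2 f2] i2]].
  case: p3 => P3' [F3 [[n3 f3] i3]]; case: p4 => P4' [F4 [[n4 f4] i4]].
  (* The extra free summand makes the third rank equal to [n1 + n2 + n3]. *)
  pose P' := KKEE P1' P2' (P3' * 'rV[R]_(n1 + n2))%type P4'.
  exists P', (dsum P P'); split; last first.
    by exists (fun x => idfun); split=> // x; exists idfun.
  apply/cfg_free_decomp; exists n1, n2, n3, n4.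
  apply: decomp_lmod_iso (decomp_dsum dP (KKEE_decomp P1' P2' _ P4')).
  + exact: lmod_iso_trans i1 f1.
  + exact: lmod_iso_trans i2 f2.
  + apply: lmod_iso_trans (lmod_iso_prodA _ _ _) _.
    apply: lmod_iso_trans (lmod_iso_rV R (addnC _ _)).
    exact: lmod_iso_prod (lmod_iso_trans i3 f3) (lmod_iso_refl _).
  + exact: lmod_iso_trans i4 f4.
- move=> P1 P2 P3 P4 _ _ _ _ /cmod_iso_KKEE[s1 [s2 [s3 [s4 sP]]]]; split.
  + by exists (lquot_pi _ \o s1); exact: gens_quot1 sP.
  + by exists (lquot_pi _ \o s2); exact: gens_quot2 sP.
  + by exists (lquot_pi _ \o s3); exact: gens_quot3 sP.
  + by exists s4; exact: gens_bij4 sP.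
- case/cfg_free_decomp=> n1 [n2 [n3 [n4 dP]]].
  exists 'rV_n1, 'rV_n2, 'rV_n3, 'rV_n4.
  split; first by split; exact: fg_free_rV.
  apply/cmod_iso_KKEE; apply: decomp_lmod_iso dP; try exact: lmod_iso_refl.
  apply/lmod_iso_sym/(lmod_iso_trans _ (lmod_iso_rV R (erefl (n1 + n2 + n3)%N))).
  exact: lmod_iso_prod (lmod_iso_rV R erefl) (lmod_iso_refl _).
- case=> F1 [F2 [F3 [F4 [[[n1 f1] [n2 f2] [n3 f3] [n4 f4]] /cmod_iso_KKEE dP]]]].
  apply/cfg_free_decomp; exists n1, n2, n3, n4.
  apply: decomp_lmod_iso dP => //.
  apply: lmod_iso_trans (lmod_iso_rV R erefl).
  apply: lmod_iso_prod f3; apply: lmod_iso_trans (lmod_iso_rV R erefl).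
  exact: lmod_iso_prod.
Qed.
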